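(* Let $k$ be a field of prime characteristic $p$ and let $G$ be a pendant cliques graph on the vertex set $[n]=\{1,\dots,n\}$, with binomial edge ideal $J_G\subseteq S=k[x_1,\dots,x_n,y_1,\dots,y_n]$. Let $\mathscr R^s(J_G)=\bigoplus_{m\ge0}J_G^{(m)}t^m\subseteq S[t]$ be the symbolic Rees algebra of $J_G$, and assume that for $R=\mathscr R^s(J_G)$ and every power $q$ of $p$ the $R$-module $R^{1/q}$ is finitely generated. Then $\mathscr R^s(J_G)$ is strongly $F$-regular.
   Context: All graphs are finite and simple. Clique join via a vertex: for a graph $H$, a vertex $v\in V(H)$ and $t\ge 2$, the clique join of $K_t$ on $H$ via $v$ is obtained from $H$ by adding $t-1$ new vertices $u_1,\dots,u_{t-1}$, all edges $\{u_i,v\}$, and all edges $\{u_i,u_j\}$, $i<j$. Pendant cliques graph: a graph obtained from a path $P$ by performing in succession clique joins of some complete graphs $K_{t_1},\dots,K_{t_m}$ via pairwise distinct vertices $v_1,\dots,v_m$ of $P$. Binomial edge ideal: for a graph $G$ on $[n]$, $J_G$ is the ideal of $S$ generated by the binomials $f_{i,j}=x_iy_j-y_ix_j$ with $\{i,j\}\in E(G)$. Symbolic power: if $I$ is an ideal of a Noetherian ring with minimal primes $\mathfrak p_1,\dots,\mathfrak p_r$, then $I^{(m)}=\mathfrak q_1\cap\dots\cap\mathfrak q_r$, where $\mathfrak q_i$ is the $\mathfrak p_i$-primary component of $I^m$; $I^{(0)}$ is the whole ring. Strongly $F$-regular: let $R$ be a reduced Noetherian domain of prime characteristic $p$ and,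 for $q$ a power of $p$, let $R^{1/q}$ be the ring obtained by adjoining all $q$-th roots of elements of $R$, regarded as an $R$-module in the natural way; suppose $R^{1/q}$ is a finitely generated $R$-module. Let $R^0$ be the complement of the union of the minimal primes of $R$. Then $R$ is strongly $F$-regular if for every $c\in R^0$ there is $e\in\mathbb N$ such that the $R$-module homomorphism $R\to R^{1/p^e}$ sending $1$ to $c^{1/p^e}$ splits as a homomorphism of $R$-modules. *)

(* Defs.v *)
From HB Require Import structures.
From mathcomp Require Import all_boot all_order all_algebra.
From mathcomp Require Import boolp classical_sets.
From mathcomp Require Import mpoly.

Set Implicit Arguments.
Unset Strict Implicit.
Unset Printing Implicit Defensive.

Import GRing.Theory.

Local Open Scope ring_scope.

Section Graphs.
Variable T : finType.

Record sgraph := SGraph {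
  vertices : {set T};
  edge : rel T;
  edge_sym : ssrbool.symmetric edge;
  edge_irr : irreflexive edge;
  edge_vertices : forall u v, edge u v -> u \in vertices }.

Definition same_graph (G H : sgraph) : Prop :=
  vertices G = vertices H /\ edge G =2 edge H.

Definition is_path (P : sgraph) : Prop :=
  exists s : seq T,
    [/\ s != [::], uniq s, vertices P =i s &
        edge P =2 fun u v => ((u, v) \in zip s (behead s)) ||
                             ((v, u) \in zip s (behead s))].

Definition clique_join (H : sgraph) (v : T) (t : nat) (H' : sgraph) : Prop :=
  [/\ v \in vertices H, (2 <= t)%N &
      exists U : {set T},
        [/\ #|U| = t.-1, [disjoint U & vertices H],
            vertices H' = vertices H :|: U &
            edge H' =2 fun x y => edge H x y ||
              [&& x != y, x \in (v |: U) & y \in (v |: U)]]].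

Fixpoint clique_joins (H : sgraph) (vt : seq (T * nat)) (G : sgraph) : Prop :=
  if vt is (v, t) :: vt' then
    exists2 H', clique_join H v t H' & clique_joins H' vt' G
  else same_graph H G.

Definition pendant_cliques (G : sgraph) : Prop :=
  exists (P : sgraph) (vt : seq (T * nat)),
    [/\ is_path P, uniq (unzip1 vt), {subset unzip1 vt <= vertices P} &
        clique_joins P vt G].

End Graphs.

Local Open Scope classical_set_scope.

Section Ideals.
Variable R : comNzRingType.
Implicit Types (I J P Q q : set R) (m r : nat).

Definition is_ideal I : Prop :=
  [/\ I 0, forall x y, I x -> I y -> I (x + y) & forall a x, I x -> I (a * x)].

Definition ideal_gen (A : set R) : set R :=
  \bigcap_(I in [set I | is_ideal I /\ A `<=` I]) I.

Definition noetherian : Prop :=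
  forall I, is_ideal I -> exists s : seq R, I = ideal_gen [set x | x \in s].

Definition prime_ideal P : Prop :=
  [/\ is_ideal P, ~ P 1 & forall x y, P (x * y) -> P x \/ P y].

Definition minimal_prime I P : Prop :=
  [/\ prime_ideal P, I `<=` P &
      forall P', prime_ideal P' -> I `<=` P' -> P' `<=` P -> P' = P].

Definition radical I : set R := [set x | exists e, I (x ^+ e)].

Definition primary_ideal Q : Prop :=
  [/\ is_ideal Q, ~ Q 1 & forall x y, Q (x * y) -> Q x \/ exists e, Q (y ^+ e)].

Definition minimal_primary_decomposition I r (Q : 'I_r -> set R) : Prop :=
  [/\ forall i, primary_ideal (Q i),
      I = \bigcap_(i in [set: 'I_r]) Q i,
      forall i j, radical (Q i) = radical (Q j) -> i = j &
      forall i, ~ (\bigcap_(j in [set j | j != i]) Q j `<=` Q i)].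

Definition primary_component I P q : Prop :=
  exists r (Q : 'I_r -> set R) (i : 'I_r),
    [/\ minimal_primary_decomposition I Q, radical (Q i) = P & Q i = q].

Definition ideal_pow I m : set R :=
  ideal_gen [set x | exists2 u : 'I_m -> R,
                       (forall i, I (u i)) & x = \prod_(i < m) u i].

(* In a Noetherian ring the component of I ^ m at a minimal prime of I exists
   and is unique, so quantifying over all of them is harmless. *)
Definition symbolic_pow I m : set R :=
  if m is 0 then setT
  else [set x | forall P q,
                  minimal_prime I P -> primary_component (ideal_pow I m) P q ->
                  q x].

Lemma ideal_gen_ideal A : is_ideal (ideal_gen A).
Proof.
split=> [|x y Ax Ay|a x Ax] I hI; have [[I0 ID IM] sAI] := hI.
- by [].
- exact: ID (Ax I hI) (Ay I hI).
- exact: IM (Ax I hI).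
Qed.

Lemma sub_ideal_gen A : A `<=` ideal_gen A.
Proof. by move=> x Ax I [_]; apply. Qed.

Lemma ideal_gen_sub A I : is_ideal I -> A `<=` I -> ideal_gen A `<=` I.
Proof. by move=> iI sAI x; apply. Qed.

Lemma ideal_genS A B : A `<=` B -> ideal_gen A `<=` ideal_gen B.
Proof.
move=> sAB; apply: ideal_gen_sub; first exact: ideal_gen_ideal.
exact: subset_trans (@sub_ideal_gen B).
Qed.

Lemma idealM (A : set R) a x : is_ideal A -> A x -> A (x * a).
Proof. by case=> _ _ AM Ax; rewrite mulrC; apply: AM. Qed.

Lemma idealB (A : set R) x y : is_ideal A -> A x -> A y -> A (x - y).
Proof.
by case=> _ AD AM Ax Ay; apply: AD => //; rewrite -mulN1r; apply: AM.
Qed.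

Lemma idealX (A : set R) x m n : is_ideal A -> (m <= n)%N ->
  A (x ^+ m) -> A (x ^+ n).
Proof. by move=> iA /subnK <- Ax; rewrite exprD; case: iA => _ _; apply. Qed.

Lemma bigcap_ideal (T : Type) (D : set T) (F : T -> set R) :
  (forall i, D i -> is_ideal (F i)) -> is_ideal (\bigcap_(i in D) F i).
Proof.
move=> iF; split=> [i Di|x y Fx Fy i Di|a x Fx i Di]; have [F0 FD FM] := iF _ Di.
- by [].
- by apply: FD; [apply: Fx | apply: Fy].
- by apply: FM; apply: Fx.
Qed.

Lemma prime_idealX P x e : prime_ideal P -> P (x ^+ e) -> P x.
Proof.
case=> _ nP1 PM; elim: e => [|e IHe]; first by rewrite expr0.
by rewrite exprS => /PM[].
Qed.

Lemma chain_sub (U : nat -> set R) m n :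
  (forall i, U i `<=` U i.+1) -> (m <= n)%N -> U m `<=` U n.
Proof.
move=> sU /subnK <-; elim: (n - m)%N => [|d IHd] //.
by apply: subset_trans (sU _).
Qed.

Lemma noetherian_chain (U : nat -> set R) :
  noetherian -> (forall i, is_ideal (U i)) -> (forall i, U i `<=` U i.+1) ->
  exists N, forall i, U i `<=` U N.
Proof.
move=> nR iU sU; have iV: is_ideal (\bigcup_i U i).
  split=> [|x y [i _ Ux] [j _ Uy]|a x [i _ Ux]].
  - by exists 0%N => //; case: (iU 0%N).
  - exists (maxn i j) => //; case: (iU (maxn i j)) => _ UD _.
    apply: UD; first exact: chain_sub (leq_maxl i j) _ Ux.
    exact: chain_sub (leq_maxr i j) _ Uy.
  - by exists i => //; case: (iU i) => _ _; apply.
have [s Vs] := nR _ iV.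
have: [set x | x \in s] `<=` \bigcup_i U i by rewrite Vs; apply: sub_ideal_gen.
move=> sV; have [N sN]: exists N, [set x | x \in s] `<=` U N.
  elim: s sV {Vs} => [|x s IHs] sV; first by exists 0%N => y.
  have [|N sN] := IHs; first by move=> y ys; apply: sV; rewrite /= inE ys orbT.
  have [|M _ Mx] := sV x; first by rewrite /= mem_head.
  exists (maxn M N) => y; rewrite /= inE => /predU1P[->|ys].
    exact: chain_sub (leq_maxl M N) _ Mx.
  exact: chain_sub (leq_maxr M N) _ (sN _ ys).
exists N => i x Ux; apply: (ideal_gen_sub (iU N) sN).
by rewrite -Vs; exists i.
Qed.

Lemma noetherian_ind (K : set R -> Prop) : noetherian ->
  (forall I, is_ideal I ->
     (forall J, is_ideal J -> I `<=` J -> I <> J -> K J) -> K I) ->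
  forall I, is_ideal I -> K I.
Proof.
move=> nR IHK I iI; apply: contrapT => nKI.
pose T := {J : set R | is_ideal J /\ ~ K J}.
have step (x : T) : {y : T | sval x `<=` sval y /\ sval x <> sval y}.
  case: x => J [iJ nKJ] /=; apply: cid; apply: contrapT => noy.
  apply: nKJ; apply: IHK => // J' iJ' sJJ' neJ; apply: contrapT => nKJ'.
  by apply: noy; exists (exist _ J' (conj iJ' nKJ')).
pose x0 : T := exist _ I (conj iI nKI).
pose U n := iter n (fun x => sval (step x)) x0.
have [|i|N UN] := @noetherian_chain (fun n => sval (U n)) nR.
- by move=> i; case: (svalP (U i)).
- by rewrite /U /=; case: (svalP (step (U i))).
- case: (svalP (step (U N))) => sU; apply; apply/seteqP; split => //.
  exact: (UN N.+1).
Qed.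

Definition intersection_of_primaries I r : Prop :=
  exists2 Q : 'I_r -> set R, (forall i, primary_ideal (Q i)) &
                             I = \bigcap_(i in [set: 'I_r]) Q i.

Lemma intersection_of_primariesI I J r s :
  intersection_of_primaries I r -> intersection_of_primaries J s ->
  intersection_of_primaries (I `&` J) (r + s).
Proof.
case=> Q pQ -> [Q' pQ' ->].
exists (fun k => match split k with inl i => Q i | inr j => Q' j end) => [k|].
  by case: (split k).
apply/seteqP; split=> [x [Qx Q'x] k _|x Qx]; first by case: (split k) => ?; [exact: Qx | exact: Q'x].
split=> i _.
  by have := Qx (lshift s i) Logic.I; rewrite (unsplitK (inl i)).
by have := Qx (rshift r i) Logic.I; rewrite (unsplitK (inr i)).
Qed.

Lemma primary_exists : noetherian ->
  forall I, is_ideal I -> exists r, intersection_of_primaries I r.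
Proof.
move=> nR; apply: noetherian_ind => // I iI IH.
have [I0 ID IM] := iI.
have [I1|nI1] := pselect (I 1).
  exists 0%N; exists (fun=> setT); first by case.
  apply/seteqP; split=> // x _.
  by rewrite -[x]mulr1; apply: IM.
have [pI|npI] := pselect (primary_ideal I).
  exists 1%N; exists (fun=> I) => //; apply/seteqP.
  by split=> [x Ix i _|x Ix] //; apply: (Ix ord0).
have [x [y [Ixy nIx nIy]]] : exists x y,
    [/\ I (x * y), ~ I x & forall e, ~ I (y ^+ e)].
  apply: contrapT => noxy; apply: npI; split=> // x y Ixy.
  apply: contrapT => /not_orP[nIx /forallNP nIy].
  by apply: noxy; exists x, y.
pose U n : set R := [set a | I (a * y ^+ n)].
have iU : forall i, is_ideal (U i).
  move=> i; split=> [|a b|a b]; rewrite /U /= ?mul0r ?mulrDl -?mulrA; auto.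
have sU : forall i, U i `<=` U i.+1.
  move=> i a Ua; rewrite /U /= in Ua *.
  by rewrite exprS mulrCA; apply: IM.
have [N UN] := noetherian_chain nR iU sU.
pose I_ (z : R) : set R := [set a | exists b c, I b /\ a = b + c * z].
have iI_ : forall z, is_ideal (I_ z).
  move=> z; split=> [|_ _ [b [c [Ib ->]]] [b' [c' [Ib' ->]]]|a _ [b [c [Ib ->]]]].
  - by exists 0, 0; rewrite mul0r addr0.
  - by exists (b + b'), (c + c'); rewrite mulrDl addrACA; split=> //; apply: ID.
  - by exists (a * b), (a * c); rewrite mulrDr mulrA; split=> //; apply: IM.
have sI_ : forall z, I `<=` I_ z by move=> z a Ia; exists a, 0; rewrite mul0r addr0.
have I_z : forall z, I_ z z by move=> z; exists 0, 1; rewrite mul1r add0r.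
have [|r pr] := IH (I_ x) (iI_ x) (sI_ x); first by move=> E; apply: nIx; rewrite E.
have [|s ps] := IH (I_ (y ^+ N)) (iI_ _) (sI_ _).
  by move=> E; apply: (nIy N); rewrite E.
exists (r + s)%N; rewrite (_ : I = I_ x `&` I_ (y ^+ N)).
  exact: intersection_of_primariesI.
apply/seteqP; split=> [a Ia|a [[b [c [Ib Ea]]] [b' [c' [Ib' Ea']]]]].
  by split; apply: sI_.
have Iay : I (a * y).
  by rewrite Ea mulrDl -mulrA; apply: ID; [apply: idealM | apply: IM].
rewrite Ea'; apply: ID => //; apply: (UN N.+1); rewrite /U /= exprSr mulrA.
rewrite (_ : c' * _ * y = a * y - b' * y); last by rewrite Ea' mulrDl addrC addKr.
by apply: idealB => //; apply: idealM.
Qed.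

Lemma primary_capI P Q : primary_ideal P -> primary_ideal Q ->
  radical P = radical Q -> primary_ideal (P `&` Q).
Proof.
move=> [iP nP1 PM] [iQ nQ1 QM] rPQ.
have key x y : P y \/ Q y -> (exists e, P (y ^+ e)) \/ (exists e, Q (y ^+ e)).
  by case; [left|right]; exists 1%N.
have rad y : (exists e, P (y ^+ e)) \/ (exists e, Q (y ^+ e)) ->
    exists e, (P `&` Q) (y ^+ e).
  move=> ry; have [[e Py] [f Qy]] : radical P y /\ radical Q y.
    by case: ry => ry; [rewrite -rPQ | rewrite rPQ].
  by exists (maxn e f); split; [apply: idealX Py | apply: idealX Qy];
     rewrite ?leq_maxl ?leq_maxr.
split.
- have [P0 PD PM'] := iP; have [Q0 QD QM'] := iQ.
  by split=> [|x y [? ?] [? ?]|a x [? ?]]; split; auto.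
- by case.
- move=> x y [/PM[Px|]]; last by move=> h _; right; apply: rad; left.
  by case/QM=> [Qx|h]; [left | right; apply: rad; right].
Qed.

Lemma radical_capI P Q : is_ideal P -> is_ideal Q ->
  radical P = radical Q -> radical (P `&` Q) = radical P.
Proof.
move=> iP iQ rPQ; apply/seteqP; split=> [x [e [Px _]]|x rPx]; first by exists e.
have [f Qx]: radical Q x by rewrite -rPQ.
have [e Px] := rPx; exists (maxn e f).
by split; [apply: idealX Px | apply: idealX Qx]; rewrite ?leq_maxl ?leq_maxr.
Qed.

Lemma minimal_primary_decomposition_exists : noetherian ->
  forall I, is_ideal I ->
  exists r (Q : 'I_r -> set R), minimal_primary_decomposition I Q.
Proof.
move=> nR I iI; have [r0 pr0] := primary_exists nR iI.
have ex : exists r, `[< intersection_of_primaries I r >].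
  by exists r0; apply/asboolP.
have [r /asboolP[Q pQ EI] minr] := ex_minnP ex.
exists r, Q; split=> // [i j rij | i].
  apply: contrapT => neij.
  case: r Q pQ EI minr i j rij neij => [|r] Q pQ EI minr i j rij neij; first by case: (i).
  have: (r.+1 <= r)%N; last by rewrite ltnn.
  apply: minr; apply/asboolP.
  exists (fun k => if lift i k == j then Q i `&` Q j else Q (lift i k)) => [k|].
    by case: ifP => // _; apply: primary_capI.
  rewrite EI; apply/seteqP; split=> x Qx k _.
    by case: ifP => _; [split|]; apply: Qx.
  have neji : i != j by apply/eqP.
  have [j' Ej _] : exists2 j', j = lift i j' & True.
    by case: (unliftP i j) => [j' ->|E]; [exists j' | rewrite E eqxx in neji].
  case: (unliftP i k) => [k' ->|->].
    by have := Qx k' Logic.I; case: eqP => [->[]|].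
  by have := Qx j' Logic.I; rewrite -Ej eqxx => -[].
move=> sQ.
case: r Q pQ EI minr i sQ => [|r] Q pQ EI minr i sQ; first by case: (i).
have: (r.+1 <= r)%N; last by rewrite ltnn.
apply: minr; apply/asboolP; exists (fun k => Q (lift i k)) => // .
rewrite EI; apply/seteqP; split=> x Qx k _; first exact: Qx.
have Qx' : (\bigcap_(j in [set j | j != i]) Q j) x.
  move=> j /= neji; case: (unliftP i j) neji => [j' ->|->]; last by rewrite eqxx.
  by move=> _; apply: Qx.
have [->|neki] := eqVneq k i; [exact: sQ | exact: Qx'].
Qed.

Lemma radical_prime Q : primary_ideal Q -> prime_ideal (radical Q).
Proof.
case=> iQ nQ1 QM; have [Q0 QD QM'] := iQ; split.
- split=> [|x y [e Qx] [f Qy]|a x [e Qx]].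
  + by exists 1%N.
  + exists (e + f)%N; rewrite exprDn; elim/big_rec: _ => // i z _ Qz.
    apply: QD => //; rewrite -mulr_natl; apply: (QM').
    have [le_fi|lt_if] := leqP f i; first by apply: QM'; apply: idealX Qy.
    apply: idealM => //; apply: idealX Qx => //.
    by rewrite -addnBA ?leq_addr // ltnW.
  + by exists e; rewrite exprMn; apply: QM'.
- by case=> e; rewrite expr1n.
- move=> x y [e]; rewrite exprMn => /QM[Qx|[f]]; first by left; exists e.
  by rewrite -exprM; right; exists (e * f)%N.
Qed.

Lemma ideal_pow_sub I m P : (0 < m)%N -> is_ideal P -> I `<=` P ->
  ideal_pow I m `<=` P.
Proof.
case: m => // m _ iP sIP; apply: ideal_gen_sub => // _ [u Iu ->].
by rewrite big_ord_recl; apply: idealM => //; apply: sIP.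
Qed.

Lemma ideal_powX I m x : I x -> ideal_pow I m (x ^+ m).
Proof.
move=> Ix; apply: sub_ideal_gen; exists (fun=> x) => //.
by rewrite prodr_const card_ord.
Qed.

Lemma ideal_powD I m n x y :
  ideal_pow I m x -> ideal_pow I n y -> ideal_pow I (m + n) (x * y).
Proof.
have iI : is_ideal (ideal_pow I (m + n)) by apply: ideal_gen_ideal.
have [K0 KD KM] := iI => Ix.
apply: (@ideal_gen_sub _ [set y | ideal_pow I (m + n) (x * y)]) => /=.
  split=> [|a b|a b] /=; rewrite ?mulr0 ?mulrDr ?[x * (a * b)]mulrCA; auto.
move=> _ [v Iv ->] /=; move: x Ix.
apply: (@ideal_gen_sub _ [set x | ideal_pow I (m + n) (x * _)]).
  split=> [|a b|a b] /=; rewrite ?mul0r ?mulrDl -?mulrA; auto.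
move=> _ [u Iu ->] /=; apply: sub_ideal_gen => /=.
exists (fun k => match split k with inl i => u i | inr j => v j end) => [k|].
  by case: (split k).
rewrite big_split_ord /=; congr (_ * _); apply: eq_bigr => i _.
  by rewrite (unsplitK (inl i)).
by rewrite (unsplitK (inr i)).
Qed.

Lemma prime_bigcap (r : nat) (Q : 'I_r -> set R) (A : set 'I_r) (P : set R) :
  (forall i, is_ideal (Q i)) -> prime_ideal P ->
  \bigcap_(i in A) Q i `<=` P -> exists2 i, A i & Q i `<=` P.
Proof.
move=> iQ [iP nP1 PM] sQP; apply: contrapT => noQ.
have w i : {x | A i -> Q i x /\ ~ P x}.
  apply: cid; have [Ai|nAi] := pselect (A i); last by exists 0.
  apply: contrapT => nox; apply: noQ; exists i => // x Qx.
  by apply: contrapT => nPx; apply: nox; exists x.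
pose y := \prod_(i < r | `[< A i >]) sval (w i).
have: P y.
  apply: sQP => i Ai; rewrite /y (bigD1 i) /=; last exact/asboolP.
  by apply: idealM => //; case: (svalP (w i) Ai).
rewrite /y; apply: (big_ind (fun z => ~ P z)) => // [a b nPa nPb /PM[]//|i /asboolP Ai].
by case: (svalP (w i) Ai).
Qed.

Lemma primary_component_exists I m P : noetherian -> (0 < m)%N ->
  minimal_prime I P -> exists q, primary_component (ideal_pow I m) P q.
Proof.
move=> nR m_gt0 [pP sIP minP]; have [iP _ _] := pP.
have [r [Q dQ]] :=
  minimal_primary_decomposition_exists nR (ideal_gen_ideal _ : is_ideal (ideal_pow I m)).
have [pQ EI _ _] := dQ.
have iQ i : is_ideal (Q i) by case: (pQ i).
have sIP' : \bigcap_(i in [set: 'I_r]) Q i `<=` P.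
  by rewrite -EI; apply: ideal_pow_sub.
have [i _ sQP] := prime_bigcap iQ pP sIP'.
exists (Q i), r, Q, i; split => //; apply: minP.
- exact: radical_prime.
- move=> x Ix; exists m.
  have: ideal_pow I m (x ^+ m) by apply: ideal_powX.
  by rewrite EI; apply.
- by move=> x [e /sQP]; apply: prime_idealX.
Qed.

(* The component at a minimal prime is the contraction of the localization. *)
Lemma primary_componentP I m P q : (0 < m)%N ->
  minimal_prime I P -> primary_component (ideal_pow I m) P q ->
  forall x, q x <-> exists2 s, ~ P s & ideal_pow I m (s * x).
Proof.
move=> m_gt0 [pP sIP minP] [r [Q [i [[pQ EI inj _] rQ <-]]]] x.
have [iP nP1 PM] := pP; split=> [Qx|[s nPs]]; last first.
  rewrite EI => /(_ i Logic.I); have [iQ _ QM] := pQ i.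
  by rewrite mulrC => /QM[//|sP]; case: nPs; rewrite -rQ.
have: ~ \bigcap_(j in [set j | j != i]) Q j `<=` P.
  have iQ j : is_ideal (Q j) by case: (pQ j).
  case/(prime_bigcap iQ pP) => j /= neji sQP.
  case/eqP: neji; apply: inj; rewrite rQ; apply: minP.
  - exact: radical_prime.
  - move=> y Iy; exists m.
    have: ideal_pow I m (y ^+ m) by apply: ideal_powX.
    by rewrite EI; apply.
  - by move=> y [e /sQP]; apply: prime_idealX.
case/existsNP => s /not_implyP[Qs nPs]; exists s => //; rewrite EI => j _.
have [iQj _ _] := pQ j.
have [->|neji] := eqVneq j i; last by apply: idealM => //; apply: Qs.
by have [[_ _ QM] _ _] := pQ i; apply: QM.
Qed.

Lemma symbolic_pow_ideal I m : is_ideal (symbolic_pow I m).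
Proof.
case: m => [|m] //.
have key P q : primary_component (ideal_pow I m.+1) P q -> is_ideal q.
  by move=> [r [Q [i [[pQ _ _ _] _ <-]]]]; case: (pQ i).
split=> [|x y Ix Iy|a x Ix] P q mP cP; have [q0 qD qM] := key _ _ cP => //.
  exact: qD (Ix _ _ mP cP) (Iy _ _ mP cP).
exact: qM (Ix _ _ mP cP).
Qed.

Lemma symbolic_powM I m n x y : noetherian ->
  symbolic_pow I m x -> symbolic_pow I n y -> symbolic_pow I (m + n) (x * y).
Proof.
move=> nR; case: m n => [|m] [|n] //.
- by move=> _; rewrite add0n; have [_ _] := symbolic_pow_ideal I n.+1; apply.
- by move=> Ix _; rewrite addn0; apply: (idealM y (symbolic_pow_ideal I m.+1) Ix).
move=> Ix Iy P q mP cP.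
have [q1 c1] := primary_component_exists nR (ltn0Sn m) mP.
have [q2 c2] := primary_component_exists nR (ltn0Sn n) mP.
have [//|s nPs Is] := (primary_componentP _ mP c1 x).1 (Ix _ _ mP c1).
have [//|t nPt It] := (primary_componentP _ mP c2 y).1 (Iy _ _ mP c2).
apply/(primary_componentP _ mP cP) => //; exists (s * t).
  by case: mP => [[_ _ PM] _ _] /PM[].
by rewrite mulrACA; apply: ideal_powD.
Qed.

End Ideals.

Lemma noetherian_field (k : fieldType) : noetherian k.
Proof.
move=> I iI; have [I0 _ IM] := iI.
have [[c [Ic c0]]|no] := pselect (exists c, I c /\ c != 0).
  exists [:: 1]; apply/seteqP; split=> [x _|x _].
    rewrite -[x]mulr1; have [_ _] := ideal_gen_ideal [set x : k | x \in [:: 1]].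
    by apply; apply: sub_ideal_gen; rewrite /= mem_head.
  by rewrite -[x](divfK c0); apply: IM.
exists [::]; apply/seteqP; split=> [x Ix|]; last exact: ideal_gen_sub.
have [->|x0] := eqVneq x 0; last by case: no; exists x.
by case: (ideal_gen_ideal [set x : k | x \in [::]]).
Qed.

Lemma noetherian_surj (A B : comNzRingType) (f : {rmorphism A -> B}) :
  (forall b, exists a, f a = b) -> noetherian A -> noetherian B.
Proof.
move=> surjf nA I iI; have [I0 ID IM] := iI.
have [|s Es] := nA [set a | I (f a)].
  by split=> [|x y|x y] /=; rewrite ?rmorph0 ?rmorphD ?rmorphM; auto.
exists (map f s); apply/seteqP; split; last first.
  apply: ideal_gen_sub => // _ /mapP[a sa ->].
  have: ideal_gen [set x | x \in s] a by apply: sub_ideal_gen.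
  by rewrite -Es.
move=> b; have [a <-] := surjf b => Ia.
have [K0 KD KM] := ideal_gen_ideal [set x | x \in map f s].
have: ideal_gen [set x | x \in s] a by rewrite -Es.
apply: (@ideal_gen_sub _ _ [set a | ideal_gen [set x | x \in map f s] (f a)]).
  by split=> [|x y|x y] /=; rewrite ?rmorph0 ?rmorphD ?rmorphM; auto.
by move=> x sx; apply: sub_ideal_gen; rewrite /= map_f.
Qed.

Section HilbertBasis.
Variable R : comNzRingType.
Implicit Types (I J : set {poly R}) (d : nat).

Let lc J d : set R :=
  [set a | exists h, [/\ J h, (size h <= d.+1)%N & h`_d = a]].

Let lc_ideal J d : is_ideal J -> is_ideal (lc J d).
Proof.
move=> [J0 JD JM]; split=> [|_ _ [g [Jg sg <-]] [h [Jh sh <-]]|a _ [h [Jh sh <-]]].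
- by exists 0; rewrite size_poly0 coef0.
- exists (g + h); rewrite coefD; split=> //; first exact: JD.
  by rewrite (leq_trans (size_polyD _ _)) // geq_max sg.
- exists (a%:P * h); rewrite coefCM; split=> //; first exact: JM.
  by rewrite mul_polyC (leq_trans (size_scale_leq _ _)).
Qed.

Let lcS J d : is_ideal J -> lc J d `<=` lc J d.+1.
Proof.
move=> [_ _ JM] _ [h [Jh sh <-]]; exists (h * 'X); split.
- by rewrite mulrC; apply: JM.
- have [->|h0] := eqVneq h 0; first by rewrite mul0r size_poly0.
  by rewrite size_mulX.
- by rewrite coefMX.
Qed.

Let lc_mono I J d : I `<=` J -> lc I d `<=` lc J d.
Proof. by move=> sIJ _ [h [Ih sh <-]]; exists h; split=> //; apply: sIJ. Qed.

Theorem hilbert_basis : noetherian R -> noetherian {poly R}.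
Proof.
move=> nR I iI.
have [N lcN] := noetherian_chain nR (fun d => lc_ideal d iI) (fun d => lcS iI).
pose gen (t : seq {poly R}) := ideal_gen [set x | x \in t].
have igen t : is_ideal (gen t) by apply: ideal_gen_ideal.
have lift d : exists2 t : seq {poly R},
    [set x | x \in t] `<=` I & lc I d `<=` lc (gen t) d.
  have [s Es] := nR _ (lc_ideal d iI).
  have [t tI st] : exists2 t : seq {poly R},
      [set x | x \in t] `<=` I & [set x | x \in s] `<=` lc (gen t) d.
    have: [set x | x \in s] `<=` lc I d by rewrite Es; apply: sub_ideal_gen.
    elim: s {Es} => [|a s IHs] sI; first by exists [::].
    have [x sx|t tI st] := IHs; first by apply: sI; rewrite /= inE sx orbT.
    have [|h [Ih sh <-]] := sI a; first by rewrite /= mem_head.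
    exists (h :: t) => [x|x]; rewrite /= inE => /predU1P[->|] //.
    - exact: tI.
    - by exists h; split=> //; apply: sub_ideal_gen; rewrite /= mem_head.
    - move=> /st; apply: lc_mono; apply: ideal_genS => y ty.
      by rewrite /= inE; apply/orP; right.
  by exists t => //; rewrite Es; apply: ideal_gen_sub => //; apply: lc_ideal.
have [t tI lct] : exists2 t : seq {poly R}, [set x | x \in t] `<=` I &
    forall d, (d < N.+1)%N -> lc I d `<=` lc (gen t) d.
  elim: N.+1 => [|M [t tI lct]]; first by exists [::].
  have [t' t'I lct'] := lift M; exists (t ++ t') => [x|d].
    by rewrite /= mem_cat => /orP[/tI|/t'I].
  rewrite ltnS leq_eqVlt => /predU1P[->|dM].
    apply: subset_trans lct' _; apply: lc_mono; apply: ideal_genS => x tx.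
    by rewrite /= mem_cat; apply/orP; right.
  apply: subset_trans (lct _ dM) _; apply: lc_mono; apply: ideal_genS => x tx.
  by rewrite /= mem_cat; apply/orP; left.
have lcI d : lc I d `<=` lc (gen t) d.
  have [dN|/ltnW Nd] := ltnP d N.+1; first exact: lct.
  apply: subset_trans (lcN d) _; apply: subset_trans (lct N _) _ => //.
  apply: (@chain_sub _ (lc (gen t)) N d) => // i; exact: lcS.
have sgI : gen t `<=` I by apply: ideal_gen_sub.
exists t; apply/seteqP; split=> // f; have [n] := ubnP (size f).
elim: n f => // n IHn f; rewrite ltnS => sf If.
have [->|f0] := eqVneq f 0; first by case: (igen t).
have [d Ed] : {d | size f = d.+1}.
  by exists (size f).-1; rewrite prednK // size_poly_gt0.
have [|h [th sh Eh]] := lcI d f`_d; first by exists f; rewrite Ed.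
rewrite -[f](subrK h); have [_ gD _] := igen t; apply: gD => //.
apply: IHn; last by apply: idealB => //; apply: sgI.
apply: leq_trans sf; rewrite Ed ltnS; apply/leq_sizeP => j dj.
rewrite coefB; have [<-|nejd] := eqVneq d j; first by rewrite Eh subrr.
have dj' : (d < j)%N by rewrite ltn_neqAle nejd.
by rewrite !nth_default ?subrr // (leq_trans _ dj') // Ed.
Qed.

End HilbertBasis.

Theorem noetherian_mpoly (k : fieldType) n : noetherian {mpoly k[n]}.
Proof.
elim: n => [|n IHn].
  apply: (@noetherian_surj k _ (@mpolyC 0 k)) (@noetherian_field k) => p.
  by exists p@_0%MM; apply/esym/nvar0_mpolyC.
pose f : {rmorphism {poly {mpoly k[n]}} -> {mpoly k[n.+1]}} :=
  horner_eval ('X_ord_max : {mpoly k[n.+1]}) \o map_poly (@mwiden n k).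
apply: (@noetherian_surj _ _ f) (hilbert_basis IHn).
elim/mpolyind => [|c m p _ _ [a <-]]; first by exists 0; rewrite rmorph0.
suff [b <-] : exists b, f b = 'X_[m].
  exists ((c%:MP)%:P * b + a); rewrite rmorphD rmorphM -mul_mpolyC; congr (_ * _ + _).
  by rewrite /f /= map_polyC /= /horner_eval hornerC mwidenC.
rewrite mpolyXE_id; apply: (big_ind (fun q => exists b, f b = q)).
- by exists 1; rewrite rmorph1.
- by move=> _ _ [a1 <-] [a2 <-]; exists (a1 * a2); rewrite rmorphM.
move=> i _; suff [b <-] : exists b, f b = 'X_i.
  by exists (b ^+ m i); rewrite rmorphXn.
have [->|] := eqVneq i ord_max.
  by exists 'X; rewrite /f /= map_polyX /horner_eval hornerX.
move=> nei; have lt_in : (i < n)%N.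
  by rewrite ltn_neqAle -ltnS ltn_ord andbT.
exists ('X_(Ordinal lt_in))%:P.
rewrite /f /= map_polyC /= /horner_eval hornerC mwidenX mnmwiden1.
by congr ('X_[U_(_)]); apply/val_inj.
Qed.

Section SymbolicRees.
Variables (k : fieldType) (n : nat) (I : set {mpoly k[n]}).

(* F = \sum_m F`_m t ^ m lies in the direct sum of the I ^ (m) t ^ m, with 'X
   standing for t. *)
Definition symbolic_rees_pred : {pred {poly {mpoly k[n]}}} :=
  [pred F : {poly {mpoly k[n]}} | `[< forall m, symbolic_pow I m F`_m >]].

Lemma symbolic_rees_subring_closed : subring_closed symbolic_rees_pred.
Proof.
have nS := @noetherian_mpoly k n; split=> [|F G|F G].
- apply/asboolP => -[|m] //; rewrite coef1 /=.
  by case: (symbolic_pow_ideal I m.+1).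
- move=> /asboolP IF /asboolP IG; apply/asboolP => m.
  by rewrite coefB; apply: idealB => //; apply: symbolic_pow_ideal.
- move=> /asboolP IF /asboolP IG; apply/asboolP => m.
  have [I0 ID _] := symbolic_pow_ideal I m.
  rewrite coefM; apply: (big_ind (symbolic_pow I m)) => // i _.
  have := symbolic_powM nS (IF i) (IG (m - i)%N).
  by rewrite subnKC // -ltnS.
Qed.

Record symbolic_rees := SymbolicRees {
  rees_val : {poly {mpoly k[n]}};
  rees_valP : rees_val \in symbolic_rees_pred }.

HB.instance Definition _ := [isSub for rees_val].
HB.instance Definition _ := [Choice of symbolic_rees by <:].
HB.instance Definition _ :=
  GRing.SubChoice_isSubComNzRing.Build _ _ symbolic_rees
    symbolic_rees_subring_closed.

Lemma symbolic_rees_pchar p : p \in [pchar k] -> p \in [pchar symbolic_rees].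
Proof.
move=> chk; have: p \in [pchar {poly {mpoly k[n]}}].
  exact: (rmorph_pchar (polyC \o @mpolyC n k)).
case/andP=> pr_p /eqP p0; apply/andP; split=> //; apply/eqP/val_inj.
by rewrite rmorph_nat p0 rmorph0.
Qed.

End SymbolicRees.

Section QthRoots.
Variables (p : nat) (R : comNzRingType) (chR : p \in [pchar R]) (e : nat).

(* R^{1/q} for q = p ^ e: the element written c : R stands for c^{1/q}, so the
   ring operations are those of R and the inclusion of R is r |-> r ^ q. *)
Definition qroot_ring of p \in [pchar R] & nat : Type := R.
Local Notation Rq := (qroot_ring chR e).

HB.instance Definition _ := GRing.ComNzRing.copy Rq R.

Definition qroot (c : R) : Rq := c.
Definition qroot_incl (r : R) : Rq := qroot (r ^+ (p ^ e)%N).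

Lemma qrootK c : qroot c ^+ (p ^ e)%N = qroot_incl c.
Proof. by []. Qed.

Lemma qroot_surj (x : Rq) : exists c, x = qroot c.
Proof. by exists x. Qed.

Lemma qroot_incl_is_zmod_morphism : zmod_morphism qroot_incl.
Proof.
have pnat : [pchar R].-nat (p ^ e)%N.
  by rewrite (eq_pnat _ (pcharf_eq chR)) pnatX pnat_id ?(pcharf_prime chR).
move=> a b; rewrite /qroot_incl /qroot.
by rewrite exprDn_pchar // exprNn_pchar.
Qed.

Lemma qroot_incl_is_monoid_morphism : monoid_morphism qroot_incl.
Proof.
by split=> [|a b]; rewrite /qroot_incl /qroot ?expr1n // exprMn.
Qed.

HB.instance Definition _ :=
  GRing.isZmodMorphism.Build R Rq qroot_incl qroot_incl_is_zmod_morphism.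
HB.instance Definition _ :=
  GRing.isMonoidMorphism.Build R Rq qroot_incl qroot_incl_is_monoid_morphism.

Lemma qroot_incl_inj : GRing.integral_domain_axiom R -> injective qroot_incl.
Proof.
move=> domR; apply: raddf_inj => r.
suff domX m : r ^+ m = 0 -> r = 0 by apply: domX.
elim: m => [|m IHm]; first by move/eqP; rewrite expr0 oner_eq0.
by rewrite exprS => /domR /orP[/eqP|/eqP].
Qed.

Definition qroot_scale (r : R) (x : Rq) : Rq := qroot_incl r * x.

Fact qroot_scaleA a b x : qroot_scale a (qroot_scale b x) = qroot_scale (a * b) x.
Proof. by rewrite /qroot_scale rmorphM mulrA. Qed.
Fact qroot_scale1 : left_id 1 qroot_scale.
Proof. by move=> x; rewrite /qroot_scale rmorph1 mul1r. Qed.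
Fact qroot_scaleDr : right_distributive qroot_scale +%R.
Proof. by move=> a x y; rewrite /qroot_scale mulrDr. Qed.
Fact qroot_scaleDl x : {morph qroot_scale^~ x : a b / a + b}.
Proof. by move=> a b; rewrite /qroot_scale rmorphD mulrDl. Qed.

HB.instance Definition _ :=
  GRing.Zmodule_isLmodule.Build R Rq
    qroot_scaleA qroot_scale1 qroot_scaleDr qroot_scaleDl.

Lemma qroot_scaleE (r : R) (x : Rq) : r *: x = qroot_incl r * x.
Proof. by []. Qed.

End QthRoots.

Definition finitely_generated (R : comNzRingType) (V : lmodType R) : Prop :=
  exists s : seq V,
    forall v, exists a : 'I_(size s) -> R, v = \sum_(i < size s) a i *: s`_i.

Section StronglyFRegular.
Variables (p : nat) (R : comNzRingType) (chR : p \in [pchar R]).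

Definition F_finite : Prop :=
  forall e, finitely_generated (qroot_ring chR e : lmodType R).

Definition strongly_F_regular : Prop :=
  [/\ GRing.integral_domain_axiom R, noetherian R, F_finite &
      forall c : R, (forall P, minimal_prime [set 0] P -> ~ P c) ->
        exists e (phi : {linear qroot_ring chR e -> R^o}),
          forall r : R, phi (r *: qroot chR e c) = r].

End StronglyFRegular.

(* In {mpoly k[n + n]} the first n variables are the x_i, the last n the y_i. *)
Definition edge_binomial (k : fieldType) n (i j : 'I_n) : {mpoly k[n + n]} :=
  'X_(lshift n i) * 'X_(rshift n j) - 'X_(rshift n i) * 'X_(lshift n j).

Lemma edge_binomialC (k : fieldType) n (i j : 'I_n) :
  edge_binomial k j i = - edge_binomial k i j.
Proof. by rewrite /edge_binomial opprB; congr (_ - _); apply: mulrC. Qed.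

Definition binomial_edge_ideal (k : fieldType) n (G : sgraph 'I_n) :
    set {mpoly k[n + n]} :=
  ideal_gen [set f | exists i j, edge G i j /\ f = edge_binomial k i j].

Arguments edge_binomial k {n} i j.
Arguments binomial_edge_ideal k {n} G.

(* Main.v *)
From HB Require Import structures.
Require Import Defs.
From mathcomp Require Import all_boot all_order all_algebra.
From mathcomp Require Import boolp classical_sets.
From mathcomp Require Import mpoly.
From mathcomp Require Import ring zify.

Set Implicit Arguments.
Unset Strict Implicit.
Unset Printing Implicit Defensive.

Import GRing.Theory.

(* Write q for p ^ e. An R-linear map R^{1/q} -> R is an additive phi : R -> R
   with phi (a ^ q x) = a phi x, and it suffices to find, for every c != 0 in
   the symbolic Rees algebra R, such a phi (for some e) with phi c = 1.

   Such maps Psi with Psi c = 1 exist on S[t] by picking out one monomial of c.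
   Multiplied by a power of f in J, Psi maps R to itself, because R is F-finite,
   and sends c to f ^ M. So only maps phi on R with phi f = 1 are needed, for one
   edge binomial f.

   List the vertices along the path as w_1, ..., w_n, each clique inserted just
   after the path vertex carrying it, and put
     D = y_{w_1} f_{w_1 w_2} ... f_{w_{n-1} w_n} x_{w_n}.
   Locally at a minimal prime P of J, the ideal J is generated by h elements, and
   D lies in the h-th power of J: writing T for the set of v with x_v, y_v in P,
   generators are these x_v, y_v together with the f_{w_i w_{i+1}} in P with
   w_i, w_{i+1} not in T. By the pigeonhole principle the trace of S^{1/q} over
   S, multiplied by D ^ (q - 2) g, maps J^(qm) to J^(m) for q > h and any g. The
   initial monomial of D is the product of all variables, so that a monomial g
   makes this map send f to 1.

   That J is locally generated as claimed only needs two facts on the minimal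
   primes, both proved by deforming the variables: a v in T has neighbours c, d
   with f_cd not in P, and f_ab is not in P if T contains neither a nor b but
   meets every edge crossing some cut that separates a from b.

   Finally F-finiteness makes R finitely generated over S by induction on the
   degree in t, hence Noetherian. *)

(** * Localization at a minimal prime *)

Section Localization.
Local Open Scope ring_scope.
Local Open Scope classical_set_scope.
Variable R : comNzRingType.
Implicit Types (I J K P : set R) (m n : nat) (x y : R).

Definition local_ideal P I : set R := [set x | exists2 s, ~ P s & I (s * x)].

Lemma sub_local_ideal P I : prime_ideal P -> I `<=` local_ideal P I.
Proof. by case=> _ nP1 _ x Ix; exists 1; rewrite ?mul1r. Qed.

Lemma local_ideal_ideal P I :
  prime_ideal P -> is_ideal I -> is_ideal (local_ideal P I).
Proof.
move=> pP [I0 ID IM]; have [_ nP1 PM] := pP.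
split=> [|x y [s nPs Isx] [t nPt Ity]|a x [s nPs Isx]].
- by exists 1; rewrite ?mulr0.
- exists (s * t); first by move/PM => [].
  by rewrite mulrDr {1}[s * t]mulrC -!mulrA; apply: ID; apply: IM.
- by exists s; rewrite // mulrCA; apply: IM.
Qed.

Lemma local_idealS P I J : I `<=` J -> local_ideal P I `<=` local_ideal P J.
Proof. by move=> sIJ x [s nPs Isx]; exists s => //; apply: sIJ. Qed.

Lemma local_idealK P I : prime_ideal P ->
  local_ideal P (local_ideal P I) `<=` local_ideal P I.
Proof.
case=> _ _ PM x [s nPs [t nPt Itsx]]; exists (t * s); first by move/PM => [].
by rewrite -mulrA.
Qed.

Lemma local_idealM P I J K : prime_ideal P ->
  (forall x y, I x -> J y -> K (x * y)) ->
  forall x y, local_ideal P I x -> local_ideal P J y -> local_ideal P K (x * y).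
Proof.
case=> _ _ PM IJK x y [s nPs Isx] [t nPt Jty].
by exists (s * t); [move/PM => [] | rewrite mulrACA; apply: IJK].
Qed.

Lemma ideal_sum I (T : Type) (r : seq T) (Q : pred T) (F : T -> R) :
  is_ideal I -> (forall i, Q i -> I (F i)) -> I (\sum_(i <- r | Q i) F i).
Proof. by case=> I0 ID _ IF; elim/big_rec: _ => // i x Qi Ix; apply: ID => //; apply: IF. Qed.

Lemma ideal_powS I m n : (m <= n)%N -> is_ideal I ->
  ideal_pow I n `<=` ideal_pow I m.
Proof.
move=> /subnK <- iI; rewrite addnC; apply: ideal_gen_sub.
  exact: ideal_gen_ideal.
move=> _ [u Iu ->]; rewrite big_split_ord /=; apply: (@idealM _ (ideal_pow I m)).
  exact: ideal_gen_ideal.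
by apply: sub_ideal_gen; exists (fun i => u (lshift (n - m) i)).
Qed.

Lemma symbolic_powP I m x : noetherian R -> (0 < m)%N ->
  symbolic_pow I m x <->
  (forall P, minimal_prime I P -> local_ideal P (ideal_pow I m) x).
Proof.
case: m => [//|m] nR _; split.
  move=> Ix P mP; have [q cP] := primary_component_exists nR (ltn0Sn m) mP.
  exact: (primary_componentP (ltn0Sn m) mP cP x).1 (Ix P q mP cP).
by move=> Ix P q mP cP; apply/(primary_componentP (ltn0Sn m) mP cP); apply: Ix.
Qed.

Lemma ideal_pow_sub_symbolic I m : noetherian R -> (0 < m)%N ->
  ideal_pow I m `<=` symbolic_pow I m.
Proof.
move=> nR m_gt0 x Ix; apply/symbolic_powP => // P [pP _ _].
exact: sub_local_ideal.
Qed.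

(* A one-parameter deformation sigma of the identity which moves I inside P
   moves P inside P as well: the x whose deformation lies in P form a prime
   between I and P. *)
Lemma minimal_prime_deformation I P (sigma : {rmorphism R -> {poly R}}) :
  minimal_prime I P -> (forall x, (sigma x)`_0 = x) ->
  (forall x, I x -> forall i, P (sigma x)`_i) ->
  forall x, P x -> forall i, P (sigma x)`_i.
Proof.
move=> [pP sIP minP] sigma0 IP; have [iP nP1 PM] := pP; have [P0 PD PM'] := iP.
pose P' : set R := [set x | forall i, P (sigma x)`_i].
suff E : P' = P by move=> x; rewrite -{1}E.
have sP'P : P' `<=` P by move=> x /(_ 0%N); rewrite sigma0.
suff pP' : prime_ideal P' by apply: minP.
split=> [||x y P'xy].
- split=> [|x y P'x P'y|a x P'x] i.
  + by rewrite rmorph0 coef0.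
  + by rewrite rmorphD coefD; apply: PD.
  + by rewrite rmorphM coefM; apply: ideal_sum => // j _; apply: PM'.
- by move=> /(_ 0%N); rewrite rmorph1 coef1.
apply: contrapT => /not_orP[/existsNP nP'x /existsNP nP'y].
(* Gauss's argument: with i and j the least indices of coefficients outside P, the coefficient of
   index i + j of the product is, modulo P, the product of those two. *)
have least z : (exists i, ~ P (sigma z)`_i) ->
    exists2 i, ~ P (sigma z)`_i & forall j, (j < i)%N -> P (sigma z)`_j.
  move=> [i0 nPi0]; have ex : exists i, ~~ `[< P (sigma z)`_i >].
    by exists i0; apply/asboolPn.
  case: (ex_minnP ex) => i /asboolPn nPi mini; exists i => // j lt_ji.
  by apply: contrapT => /asboolPn/mini; rewrite leqNgt lt_ji.
have [i nPi lti] := least x nP'x; have [j nPj ltj] := least y nP'y.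
have := P'xy (i + j)%N; rewrite rmorphM coefM.
have lt_i : (i < (i + j).+1)%N by rewrite ltnS leq_addr.
rewrite (bigD1 (Ordinal lt_i)) //= addKn => Pij.
suff /(idealB iP Pij) : P (\sum_(l < (i + j).+1 | l != Ordinal lt_i)
    (sigma x)`_l * (sigma y)`_(i + j - l)) by rewrite addrK => /PM[].
apply: ideal_sum => // l ne_li; have [lt_li|] := ltnP l i.
  by apply: idealM => //; apply: lti.
rewrite leq_eqVlt => /predU1P[E|lt_il]; first by case/eqP: ne_li; apply: val_inj.
by apply: PM'; apply: ltj; have := ltn_ord l; lia.
Qed.

End Localization.

(** * Linear maps from R^{1/q} to R *)

Section RootLinear.
Local Open Scope ring_scope.
Variables (p : nat).

(* The maps that are R-linear when their source is read as R^{1/q}, q = p^e. *)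
Definition root_linear (R : comNzRingType) e (phi : R -> R) : Prop :=
  {morph phi : x y / x + y} /\
  forall a x, phi (a ^+ (p ^ e)%N * x) = a * phi x.

Variable R : comNzRingType.
Implicit Types (phi psi : R -> R) (e f : nat).

Lemma root_linear0 e phi : root_linear e phi -> phi 0 = 0.
Proof. by case=> phiD _; apply: (addrI (phi 0)); rewrite -phiD !addr0. Qed.

Lemma root_linear_sum e phi : root_linear e phi ->
  forall (T : Type) (r : seq T) (Q : pred T) (F : T -> R),
  phi (\sum_(i <- r | Q i) F i) = \sum_(i <- r | Q i) phi (F i).
Proof.
move=> lphi T r Q F; have phi0 := root_linear0 lphi.
by case: lphi => phiD _; apply: (big_morph phi phiD phi0).
Qed.

Lemma root_linear_id : root_linear 0 (id : R -> R).
Proof. by split=> // a x; rewrite expn0 expr1. Qed.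

Lemma root_linear_comp e f phi psi : root_linear e phi -> root_linear f psi ->
  root_linear (e + f) (phi \o psi).
Proof.
move=> [phiD phiM] [psiD psiM]; split=> [x y|a x] /=.
  by rewrite psiD phiD.
by rewrite expnD exprM psiM phiM.
Qed.

Lemma root_linear_mull e phi b : root_linear e phi ->
  root_linear e (fun x => phi (b * x)).
Proof.
by move=> [phiD phiM]; split=> [x y|a x]; rewrite ?mulrDr ?phiD // mulrCA phiM.
Qed.

Lemma root_linear_scale e phi b : root_linear e phi ->
  root_linear e (fun x => b * phi x).
Proof.
by move=> [phiD phiM]; split=> [x y|a x]; rewrite ?phiD ?mulrDr // phiM mulrCA.
Qed.

Lemma root_linear_iter phi : root_linear 1 phi -> phi 1 = 1 ->
  forall e, exists2 psi : R -> R, root_linear e psi & psi 1 = 1.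
Proof.
move=> lphi phi1; elim=> [|e [psi lpsi psi1]].
  by exists id => //; apply: root_linear_id.
by exists (phi \o psi); [rewrite -add1n; apply: root_linear_comp | rewrite /= psi1].
Qed.

(** Induction on N: if [psi] sends c^N to 1 and q = p^f, then c^(q-1) c^(N+1) = c^q c^N goes to c
    under [psi], and then to 1 under [phi]. *)
Lemma root_linear_power e phi c : (0 < p)%N -> root_linear e phi -> phi c = 1 ->
  forall N, exists f (psi : R -> R), root_linear f psi /\ psi (c ^+ N) = 1.
Proof.
move=> p_gt0 lphi phic; elim=> [|N [f [psi [lpsi psic]]]].
  by exists 0%N, id; split; [apply: root_linear_id | rewrite expr0].
pose q := (p ^ f)%N; have q_gt0 : (0 < q)%N by rewrite expn_gt0 p_gt0.
exists (e + f)%N, (fun x => (phi \o psi) (c ^+ q.-1 * x)); split.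
  by apply: root_linear_mull; apply: root_linear_comp.
have -> : c ^+ q.-1 * c ^+ N.+1 = c ^+ q * c ^+ N.
  by rewrite -!exprD; congr (c ^+ _); lia.
by rewrite /=; case: lpsi => _ ->; rewrite psic mulr1.
Qed.

Hypothesis chR : p \in [pchar R].

(** Apply [phi] to the coefficients and keep the exponents congruent to j modulo q; in root
    notation, t^(m + j/q) goes to t^m. *)
Lemma root_linear_poly e phi j : root_linear e phi -> (j < p ^ e)%N ->
  exists2 Phi : {poly R} -> {poly R},
    root_linear e Phi & forall F m, (Phi F)`_m = phi F`_(m * p ^ e + j).
Proof.
move=> lphi lt_j; have [phiD phiM] := lphi; set q := (p ^ e)%N in lt_j phiM *.
have phi0 := root_linear0 lphi.
pose Phi (F : {poly R}) := \poly_(m < size F) phi F`_(m * q + j).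
have coefPhi F m : (Phi F)`_m = phi F`_(m * q + j).
  rewrite coef_poly; case: ltnP => // le_Fm; rewrite nth_default ?phi0 //.
  by rewrite (leq_trans le_Fm) // (leq_trans _ (leq_addr _ _)) // leq_pmulr //; lia.
have PhiD : {morph Phi : x y / x + y}.
  by move=> x y; apply/polyP => m; rewrite !(coefPhi, coefD) phiD.
exists Phi => //; split=> // a x.
have chP : p \in [pchar {poly R}] by apply: (rmorph_pchar (polyC : {rmorphism R -> {poly R}})).
have pnat : [pchar {poly R}].-nat q.
  by rewrite (eq_pnat _ (pcharf_eq chP)) pnatX pnat_id ?(pcharf_prime chP).
(* Additivity of the q-th power reduces the claim to constants and to a factor t, whose q-th power
   shifts the coefficients by q. *)
elim/poly_ind: a x => [|a c IHa] x.
  rewrite expr0n; have -> : (q == 0)%N = false by lia.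
  by rewrite !mul0r; apply/polyP => m; rewrite coefPhi !coef0 phi0.
rewrite exprDn_pchar // !mulrDl PhiD; congr (_ + _); last first.
  by apply/polyP => m; rewrite -polyC_exp coefPhi !coefCM phiM coefPhi.
rewrite exprMn mulrAC [in RHS]mulrAC -IHa; apply/polyP => m.
rewrite coefPhi coefMXn coefMX; case: m => [|m] /=; first by rewrite mul0n lt_j phi0.
rewrite coefPhi; case: ifP => [|_]; first by lia.
by congr (phi _`_ _); rewrite mulSn; lia.
Qed.

End RootLinear.

(** * Root-linear maps on polynomial rings in several variables *)

Section RootLinearMpoly.
Local Open Scope ring_scope.
Variables (p n : nat) (k : fieldType).

Lemma mcoeffMX_eq0 (F : {mpoly k[n]}) (m b : 'X_{1..n}) :
  ~~ (m <= b)%MM -> (F * 'X_[m])@_b = 0.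
Proof.
move=> nle; apply: memN_msupp_eq0; rewrite (perm_mem (msuppMX _ _)).
apply/mapP => -[m' _ E]; case/negP: nle; apply/mnm_lepP => i.
by rewrite E mnmDE leq_addr.
Qed.

Hypothesis chk : p \in [pchar k].

(** The same construction in several variables. With every entry of [a] equal to q - 1 it is the
    trace map used later. *)
Lemma root_linear_mpoly e (tau : k -> k) (a : 'X_{1..n}) :
  root_linear p e tau -> (forall i, a i < p ^ e)%N ->
  exists2 Theta : {mpoly k[n]} -> {mpoly k[n]}, root_linear p e Theta &
    forall F b, (Theta F)@_b = tau F@_(b *+ (p ^ e) + a).
Proof.
move=> ltau lt_a; have tau0 := root_linear0 ltau; have [tauD tauM] := ltau.
set q := (p ^ e)%N in lt_a tauM *.
(* The only exponent b for which m = q b + a is possible, because the entries of a are below q. *)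
pose dv (m : 'X_{1..n}) := [multinom (m i %/ q)%N | i < n].
have dvE b : dv (b *+ q + a)%MM = b.
  apply/mnmP => i; rewrite mnmE mnmDE mulmnE divnMDl ?divn_small ?addn0 //.
  by rewrite (leq_ltn_trans _ (lt_a i)).
pose Theta (F : {mpoly k[n]}) : {mpoly k[n]} :=
  \sum_(m <- msupp F | m == (dv m *+ q + a)%MM) tau F@_m *: 'X_[dv m].
have coefT F b : (Theta F)@_b = tau F@_(b *+ q + a).
  rewrite raddf_sum /=; set m0 := (b *+ q + a)%MM.
  have off m : m != m0 -> m == (dv m *+ q + a)%MM ->
      (tau F@_m *: 'X_[dv m] : {mpoly k[n]})@_b = 0.
    rewrite mcoeffZ mcoeffX => ne /eqP E; case: eqP => [Eb|]; last by rewrite mulr0.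
    by rewrite E Eb eqxx in ne.
  have [m0F|m0F] := boolP (m0 \in msupp F); last first.
    rewrite (memN_msupp_eq0 m0F) tau0 big_seq_cond big1 // => m /andP[mF Em].
    by apply: off => //; apply: contraNneq m0F => <-.
  rewrite big_mkcond (bigD1_seq m0) ?msupp_uniq //= big1 => [|m ne].
    by rewrite dvE eqxx mcoeffZ mcoeffX eqxx mulr1 addr0.
  by case: ifP => // Em; apply: off.
have TD : {morph Theta : x y / x + y}.
  by move=> x y; apply/mpolyP => m; rewrite mcoeffD !coefT mcoeffD tauD.
exists Theta => //; split=> // G x; rewrite -/q.
have chS : p \in [pchar {mpoly k[n]}].
  exact: (rmorph_pchar (@mpolyC n k)).
have pnat : [pchar {mpoly k[n]}].-nat q.
  by rewrite (eq_pnat _ (pcharf_eq chS)) pnatX pnat_id ?(pcharf_prime chS).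
elim/mpolyind: G => [|c m G _ _ IHG].
  rewrite expr0n; have [q0|_] := eqVneq q 0%N.
    by move: q0 pnat => ->.
  by rewrite !mul0r; apply/mpolyP => m; rewrite coefT !mcoeff0 tau0.
have -> : (c *: 'X_[m] + G) ^+ q = (c *: 'X_[m]) ^+ q + G ^+ q.
  exact: exprDn_pchar pnat.
rewrite (mulrDl ((c *: 'X_[m]) ^+ q) (G ^+ q) x) TD IHG (mulrDl (c *: 'X_[m]) G).
congr (_ + _); apply/mpolyP => b.
rewrite coefT exprZn mpolyXn -!scalerAl !mcoeffZ tauM ![_ * x]mulrC ![_ * Theta x]mulrC.
congr (_ * _).
have [le_mb|nle] := boolP (m <= b)%MM.
  rewrite -[b](submK le_mb) [(b - m + m)%MM]addmC mcoeffMX coefT.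
  have -> : ((m + (b - m)) *+ q + a = m *+ q + ((b - m) *+ q + a))%MM.
    by apply/mnmP => i; rewrite !(mnmDE, mulmnE) mulnDl addnA.
  by rewrite mcoeffMX.
(* If m_i > b_i, then q m_i >= q b_i + q > q b_i + a_i, so both coefficients vanish. *)
rewrite !mcoeffMX_eq0 //; apply: contra nle => /mnm_lepP le_mb.
apply/mnm_lepP => i; have := le_mb i; have := lt_a i.
rewrite mnmDE !mulmnE => lt_ai le_mi; rewrite leqNgt; apply/negP => lt_bm.
have : ((b i).+1 * q <= m i * q)%N by rewrite leq_mul2r lt_bm orbT.
by rewrite mulSn; lia.
Qed.

(* The monomials of F other than a have degree too small to reach a + q b. *)
Lemma root_linear_mpoly_eq1 e (tau : k -> k) (a : 'X_{1..n})
    (Theta : {mpoly k[n]} -> {mpoly k[n]}) (F : {mpoly k[n]}) :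
  tau 0 = 0 -> tau 1 = 1 ->
  (forall G b, (Theta G)@_b = tau G@_(b *+ (p ^ e) + a)) ->
  F@_a = 1 -> (msize F <= mdeg a + p ^ e)%N -> Theta F = 1.
Proof.
move=> tau0 tau1 coefT Fa leF; apply/mpolyP => b; rewrite coefT mcoeff1.
have [->|b0] := eqVneq b 0%MM; first last.
  rewrite memN_msupp_eq0 ?tau0 //; apply: msize_mdeg_ge; apply: leq_trans leF _.
  by rewrite mdegD mdegMn addnC leq_add2r leq_pmull // lt0n mdeg_eq0.
have -> : (0 *+ (p ^ e) + a = a)%MM by apply/mnmP => i; rewrite mnmDE mulmnE mnm0E.
by rewrite Fa tau1.
Qed.

End RootLinearMpoly.

(** * Splitting the Frobenius of the ground field *)

Section FFinite.
Local Open Scope ring_scope.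
Variables (p : nat).

(** Choose a minimal set A of indices such that 1 and the s_i with i in A span k over k^p.
    Minimality makes the coefficient of 1 unique, and [tau] takes its p-th root. *)
Lemma root_linear_functional (k : fieldType) (chk : p \in [pchar k]) h (s : 'I_h -> k) :
  (forall x, exists a : 'I_h -> k,
     x = \sum_(i < h) a i ^+ p * s i) ->
  exists2 tau : k -> k, root_linear p 1 tau & tau 1 = 1.
Proof.
move=> genS; pose gen (A : {set 'I_h}) := forall x, exists c (a : 'I_h -> k),
  x = c ^+ p + \sum_(i in A) a i ^+ p * s i.
have p_gt0 : (0 < p)%N by rewrite prime_gt0 // (pcharf_prime chk).
have pnat : [pchar k].-nat p.
  by rewrite (eq_pnat _ (pcharf_eq chk)) pnat_id // (pcharf_prime chk).
have powD (x y : k) : (x + y) ^+ p = x ^+ p + y ^+ p by rewrite exprDn_pchar.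
have powN (x : k) : (- x) ^+ p = - x ^+ p by rewrite exprNn_pchar.
have pow0 : (0 : k) ^+ p = 0 by rewrite expr0n gtn_eqF.
have gT : `[< gen [set: 'I_h] >].
  apply/asboolP => x; have [a ->] := genS x.
  by exists 0, a; rewrite pow0 add0r; apply: eq_bigl => i; rewrite inE.
have [A /asboolP genA minA] := @arg_minnP _ _ (fun A => `[< gen A >]) (fun A => #|A|) gT.
(* A relation with some a_i nonzero would express s_i through 1 and the other generators, against
   the minimality of A. *)
have free c (a : 'I_h -> k) :
    c ^+ p + \sum_(i in A) a i ^+ p * s i = 0 -> c = 0.
  move=> rel; have [/existsP[i /andP[iA ai]]|] := boolP [exists i in A, a i != 0]; last first.
    rewrite negb_exists_in => /forall_inP a0; move: rel.
    rewrite big1 => [|i /a0]; last by rewrite negbK => /eqP->; rewrite pow0 mul0r.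
    by rewrite addr0 => /eqP; rewrite expf_eq0 => /andP[_ /eqP].
  suff /minA : `[< gen (A :\ i) >] by rewrite (cardsD1 i A) iA add1n ltnn.
  apply/asboolP => x; have [c' [a' ->]] := genA x.
  exists (c' - a' i / a i * c), (fun j => a' j - a' i / a i * a j).
  move: rel; rewrite !(big_setD1 i iA) /=.
  under [X in _ -> _ = _ + X]eq_bigr do rewrite powD powN exprMn mulrDl mulNr -mulrA.
  rewrite big_split /= sumrN -mulr_sumr => rel.
  rewrite powD powN exprMn; set u := (a' i / a i) ^+ p.
  have -> : a' i ^+ p = u * a i ^+ p by rewrite -exprMn divfK.
  move: rel; set B := \sum_(j in _) _; set C := \sum_(j in _) _ => rel.
  have -> : B = - (c ^+ p + a i ^+ p * s i).
    by apply: (addrI (c ^+ p + a i ^+ p * s i)); rewrite subrr -addrA.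
  ring.
have [cd cdP] := choice genA.
have cdE x c (a : 'I_h -> k) : x = c ^+ p + \sum_(i in A) a i ^+ p * s i -> cd x = c.
  have [a' Ex] := cdP x; move=> E; apply/eqP; rewrite -subr_eq0; apply/eqP.
  apply: (free _ (fun i => a' i - a i)).
  rewrite powD powN; under eq_bigr do rewrite /= powD powN mulrDl mulNr.
  by rewrite big_split /= sumrN addrACA -opprD -Ex -E subrr.
exists cd; last first.
  apply: (cdE _ _ (fun=> 0)); rewrite expr1n big1 ?addr0 // => i _.
  by rewrite pow0 mul0r.
split=> [x y|b x].
  have [a Ex] := cdP x; have [a' Ey] := cdP y.
  apply: (cdE _ _ (fun i => a i + a' i)); rewrite powD.
  under eq_bigr do rewrite /= powD mulrDl.
  by rewrite big_split /= addrACA -Ex -Ey.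
have [a Ex] := cdP x; apply: (cdE _ _ (fun i => b * a i)).
under eq_bigr do rewrite /= exprMn -mulrA.
by rewrite exprMn -mulr_sumr -mulrDr -Ex expn1.
Qed.

End FFinite.

(** * Powers of a locally generated ideal *)

Section GeneratorPowers.
Local Open Scope ring_scope.
Local Open Scope classical_set_scope.
Variable R : comNzRingType.
Implicit Types (I J P : set R) (z : seq R) (m N : nat) (x y : R).

(** The N-th power of the ideal generated by [z], presented by explicit exponents because these get
    divided by q. *)
Definition gen_pow (z : seq R) (N : nat) : set R :=
  ideal_gen [set x | exists2 a : 'I_(size z) -> nat,
    (N <= \sum_(i < size z) a i)%N & x = \prod_(i < size z) z`_i ^+ a i].

Lemma gen_pow_ideal z N : is_ideal (gen_pow z N).
Proof. exact: ideal_gen_ideal. Qed.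

Lemma gen_powS z m N : (m <= N)%N -> gen_pow z N `<=` gen_pow z m.
Proof.
by move=> le_mN; apply: ideal_genS => _ [a le_a ->]; exists a => //; apply: leq_trans le_a.
Qed.

Lemma gen_powD z m N x y :
  gen_pow z m x -> gen_pow z N y -> gen_pow z (m + N) (x * y).
Proof.
have [K0 KD KM] := gen_pow_ideal z (m + N) => Ix.
apply: (@ideal_gen_sub R _ [set y | gen_pow z (m + N) (x * y)]) => /=.
  split=> [|a b|a b] /=; rewrite ?mulr0 ?mulrDr ?[x * (a * b)]mulrCA; auto.
move=> _ [b le_b ->] /=; move: x Ix.
apply: (@ideal_gen_sub R _ [set x | gen_pow z (m + N) (x * _)]).
  split=> [|c d|c d] /=; rewrite ?mul0r ?mulrDl -?mulrA; auto.
move=> _ [a le_a ->] /=; apply: sub_ideal_gen; exists (fun i => (a i + b i)%N).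
  by rewrite big_split leq_add.
by rewrite -big_split; apply: eq_bigr => i _; rewrite exprD.
Qed.

Lemma gen_pow0 z x : gen_pow z 0 x.
Proof.
rewrite -[x]mulr1; case: (gen_pow_ideal z 0) => _ _; apply.
by apply: sub_ideal_gen; exists (fun=> 0%N) => //; rewrite big1 // => i; rewrite expr0.
Qed.

Lemma gen_pow1 z x : x \in z -> gen_pow z 1 x.
Proof.
move=> zx; have lt_i : (index x z < size z)%N by rewrite index_mem.
apply: sub_ideal_gen; exists (fun i => (i == Ordinal lt_i) : nat).
  by rewrite (bigD1 (Ordinal lt_i)) //= eqxx.
rewrite (bigD1 (Ordinal lt_i)) //= eqxx expr1 nth_index // big1 ?mulr1 // => i.
by move/negPf->; rewrite expr0.
Qed.

Lemma gen_powX z N x m : gen_pow z N x -> gen_pow z (N * m) (x ^+ m).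
Proof.
move=> zx; elim: m => [|m IHm]; first by rewrite muln0; apply: gen_pow0.
by rewrite mulnS exprS; apply: gen_powD.
Qed.

Lemma ideal_pow_local_gen_pow P J z m :
  prime_ideal P -> J `<=` local_ideal P (gen_pow z 1) ->
  ideal_pow J m `<=` local_ideal P (gen_pow z m).
Proof.
move=> pP sJz; have iL N := local_ideal_ideal pP (gen_pow_ideal z N).
apply: ideal_gen_sub => // _ [u Ju ->]; elim: m u Ju => [|m IHm] u Ju.
  by apply: sub_local_ideal => //; apply: gen_pow0.
rewrite big_ord_recl.
apply: (local_idealM pP (@gen_powD z 1 m) _ (IHm _ _)) => //.
exact: sJz.
Qed.

Lemma gen_pow_local_ideal_pow P J z m : prime_ideal P -> is_ideal J ->
  {in z, forall x, local_ideal P J x} ->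
  gen_pow z m `<=` local_ideal P (ideal_pow J m).
Proof.
move=> pP iJ zJ; apply: ideal_gen_sub.
  by apply: local_ideal_ideal => //; apply: ideal_gen_ideal.
move=> _ [a le_a ->]; apply: local_idealS (ideal_powS le_a iJ) _ _.
apply: (big_rec2 (fun m x => local_ideal P (ideal_pow J m) x)) => [|i N x _ Jx].
  apply: sub_local_ideal => //; apply: sub_ideal_gen => /=.
  by exists (fun=> 0); rewrite ?big_ord0 // => -[].
apply: (local_idealM pP (@ideal_powD _ J _ _) _ Jx); move: (a i) => {le_a}d.
elim: d => [|d IHd]; last first.
  rewrite exprS; apply: (local_idealM pP (@ideal_powD _ J 1 d) _ IHd).
  apply: local_idealS (zJ _ (mem_nth _ (ltn_ord i))) => y Jy.
  by rewrite -[y]expr1; apply: ideal_powX.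
apply: sub_local_ideal => //; apply: sub_ideal_gen => /=.
by exists (fun=> 0); rewrite ?big_ord0 // => -[].
Qed.

Variable p : nat.

(** Divide the exponents of a monomial by q with remainder. The quotients leave [Theta]; the
    remainders add up to at most h(q-1), with h the length of [z]. Quotients of sum at most m - 1
    would thus give degree at most q(m-1) + h(q-1) < N. *)
Lemma root_linear_gen_pow e (Theta : R -> R) z m N x :
  (0 < p)%N -> root_linear p e Theta ->
  (p ^ e * m + (size z).-1 * (p ^ e).-1 <= N)%N ->
  gen_pow z N x -> gen_pow z m (Theta x).
Proof.
move=> p_gt0 lT; have T0 := root_linear0 lT; have [TD TM] := lT.
have [K0 KD KM] := gen_pow_ideal z m.
have : (0 < p ^ e)%N by rewrite expn_gt0 p_gt0.
set q := (p ^ e)%N in TM * => q_gt0 le_N zx.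
(* [Theta] is linear only over q-th powers; the free factor g makes the set of good x an ideal. *)
suff Tg g : gen_pow z m (Theta (g * x)) by rewrite -[x]mul1r.
move: x zx g; apply: (@ideal_gen_sub R _ [set x | forall g, gen_pow z m (Theta (g * x))]).
  split=> [g|x y zx zy g|a x zx g].
  - by rewrite mulr0 T0.
  - by rewrite mulrDr TD; apply: KD.
  - by rewrite mulrA.
move=> _ [a le_a ->] g /=.
have -> : \prod_(i < size z) z`_i ^+ a i =
    (\prod_(i < size z) z`_i ^+ (a i %/ q)) ^+ q * \prod_(i < size z) z`_i ^+ (a i %% q).
  rewrite -prodrXl -big_split; apply: eq_bigr => i _.
  by rewrite /= -exprM -exprD -divn_eq.
rewrite mulrCA TM mulrC; apply: KM; apply: sub_ideal_gen.
exists (fun i => (a i %/ q)%N) => //.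
have le_mod : (\sum_(i < size z) a i %% q <= size z * q.-1)%N.
  rewrite -[X in (_ <= X * _)%N]card_ord -sum_nat_const; apply: leq_sum => i _.
  by rewrite -ltnS prednK // ltn_pmod.
have E : (\sum_(i < size z) a i = q * (\sum_(i < size z) a i %/ q) + \sum_(i < size z) a i %% q)%N.
  rewrite big_distrr -big_split; apply: eq_bigr => i _ /=.
  by rewrite mulnC -divn_eq.
move: le_a le_N le_mod; rewrite E; move: (\sum_i _ %% q)%N (\sum_i _ %/ q)%N => r b.
case: (size z) => [|h] /=; rewrite leqNgt; [move=> *|move=> *]; apply/negP; nia.
Qed.

(* Locally at P the ideal J is generated by the h elements of z; a monomial of
   degree qm + (h-1)(q-1) in them is divisible by the q-th power of one of
   degree m, so Theta sends E J^(qm) to J^(m) as soon as E lies in the power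
   (h-1)(q-1). *)
Lemma root_linear_symbolic e (Theta : R -> R) J E m x :
  noetherian R -> is_ideal J -> (0 < p)%N -> root_linear p e Theta ->
  (forall P, minimal_prime J P -> exists z M,
     [/\ {in z, forall x, local_ideal P J x}, J `<=` local_ideal P (gen_pow z 1),
         local_ideal P (gen_pow z M) E & ((size z).-1 * (p ^ e).-1 <= M)%N]) ->
  symbolic_pow J (m * p ^ e) x -> symbolic_pow J m (Theta (E * x)).
Proof.
move=> nR iJ p_gt0 lT locJ Jx; have [->//|m_gt0] := posnP m.
have q_gt0 : (0 < p ^ e)%N by rewrite expn_gt0 p_gt0.
apply/symbolic_powP => // P mP; have [pP _ _] := mP.
have [z [M [zJ sJz zE leM]]] := locJ P mP.
have Px : local_ideal P (gen_pow z (m * p ^ e)) x.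
  apply: local_idealK => //; apply: local_idealS (ideal_pow_local_gen_pow pP sJz) _ _.
  by move/symbolic_powP: Jx; apply => //; rewrite muln_gt0 m_gt0.
have [s nPs] := local_idealM pP (@gen_powD z _ _) zE Px.
move=> zsEx; apply: local_idealK => //.
apply: local_idealS (gen_pow_local_ideal_pow pP iJ zJ) _ _.
(* Multiplying by s^(q-1) turns the denominator s into s^q, which leaves [Theta] as s, still outside
   P. *)
exists s => //; rewrite -(proj2 lT); apply: (root_linear_gen_pow p_gt0 lT (leqnn _)).
have -> : s ^+ (p ^ e) * (E * x) = s ^+ (p ^ e).-1 * (s * (E * x)).
  by rewrite [in RHS]mulrA -exprSr prednK.
have [_ _ KM] := gen_pow_ideal z (p ^ e * m + (size z).-1 * (p ^ e).-1).
apply: KM; apply: gen_powS zsEx; rewrite addnC [(p ^ e * m)%N]mulnC leq_add //.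
Qed.

End GeneratorPowers.

(** * Orderings of pendant cliques graphs *)

Section CliqueOrder.
Variable T : finType.
Implicit Types (G H : sgraph T) (s : seq T) (a b c d m u v x y : T).

Definition simplicial G m : Prop :=
  forall c d, edge G m c -> edge G m d -> c != d -> edge G c d.

(* Such an ordering makes every connected component of G minus a cut set an
   interval of the remaining vertices. *)
Definition clique_order G s : Prop :=
  [/\ uniq s, vertices G =i s,
      forall a b, b \in s -> index b s = (index a s).+1 ->
        edge G a b \/ exists v, [/\ edge G v a, edge G v b &
          forall x y, edge G x y -> index x s <= index a s ->
            index b s <= index y s -> x = v \/ y = v] &
      forall x y m, m \in s -> edge G x y -> index x s < index m s ->
        index m s < index y s -> simplicial G m].

(* v can still receive a clique, to be inserted just after v. *)
Definition open_vertex G s v : Prop :=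
  [/\ v \in s,
      forall x y, edge G x y -> index x s < index v s -> index y s <= index v s &
      forall b, b \in s -> index b s = (index v s).+1 -> edge G v b].

Lemma mem_zip_behead x s u v : uniq (x :: s) ->
  ((u, v) \in zip (x :: s) s) = (v \in s) && (index v (x :: s) == (index u (x :: s)).+1).
Proof.
elim: s x => // y s IHs x; rewrite [uniq _]/= => /andP[xs /= /IHs].
rewrite /= in IHs * => {}IHs; rewrite inE xpair_eqE IHs inE.
have nxy : y != x by apply: contraNneq xs => <-; rewrite mem_head.
have [->|nyv] := eqVneq v y; rewrite ?eqxx /=.
  rewrite (eq_sym x) (negPf nxy) andbT eqSS; case: eqVneq => //= nux.
  by rewrite andbF.
rewrite andbF /=; case vs: (v \in s) => //=.
have nxv : x != v by apply: contraNneq xs => ->; rewrite inE vs orbT.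
rewrite (negPf nxv) eqSS; have [<-|nxu] := eqVneq x u; last by [].
move: xs; rewrite inE negb_or => /andP[_ xs].
rewrite (negPf nxy) [RHS]/=; apply/negbTE; rewrite neq_ltn ltnS ltnW //.
by rewrite (memNindex xs) index_mem.
Qed.

(** The order along the path works: edges join consecutive vertices, so none passes over a
    vertex. *)
Lemma path_clique_order P : is_path P ->
  exists s, clique_order P s /\ {in vertices P, forall v, open_vertex P s v}.
Proof.
case=> -[|x s]; first by case.
move=> [_ Us Ps EP]; set w := x :: s in Us Ps EP *.
have edgeE u v : edge P u v = (v \in w) && (index v w == (index u w).+1) ||
                              (u \in w) && (index u w == (index v w).+1).
  have E a b : ((a, b) \in zip w s) = (b \in w) && (index b w == (index a w).+1).
    rewrite mem_zip_behead // [b \in w]inE; have [->|//] := eqVneq b x.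
    by rewrite /= eqxx andbF.
  by rewrite EP !E.
clearbody w; exists w; split.
  split=> // [a b bw E|y z m _]; first by left; rewrite edgeE bw E eqxx.
  by rewrite edgeE => /orP[] /andP[_ /eqP]; lia.
move=> v; rewrite Ps => vw; split=> // [y z|b bw E].
  by rewrite edgeE => /orP[] /andP[_ /eqP]; lia.
by rewrite edgeE bw E eqxx.
Qed.

Lemma index_insert s1 s2 v (U : seq T) : uniq (s1 ++ v :: s2) ->
  {in U, forall x, x \notin s1 ++ v :: s2} ->
  let s := s1 ++ v :: s2 in let s' := s1 ++ v :: U ++ s2 in
  [/\ {in s, forall x, index x s' =
         if index x s <= index v s then index x s else index x s + size U} &
      {in U, forall x, index x s' = index v s + 1 + index x U}].
Proof.
rewrite cat_uniq => /and3P[_ /hasPn nv]; rewrite /= => /andP[vs2 _] Us /=.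
have vs1 : v \notin s1 by apply: nv; rewrite mem_head.
have idv : index v (s1 ++ v :: s2) = size s1.
  by rewrite index_cat (negPf vs1) /= eqxx addn0.
split=> x xs.
  rewrite idv !index_cat; case xs1: (x \in s1); first by rewrite ltnW // index_mem.
  rewrite /= ; have [_|nxv] := eqVneq v x; first by rewrite addn0 leqnn.
  have -> : (size s1 + (index x s2).+1 <= size s1) = false by lia.
  rewrite index_cat; case: ifP => [/Us|_]; first by rewrite xs.
  by rewrite -addnA addSn [size U + _]addnC.
have := Us x xs; rewrite mem_cat inE !negb_or => /and3P[/negPf xs1 nxv _].
by rewrite idv index_cat xs1 /= eq_sym (negPf nxv) index_cat xs; lia.
Qed.

(** The new vertices go directly after v. Old edges keep their relative position, new ones stay
    inside the block formed by v and U, and every other open vertex keeps its successor. *)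
Lemma clique_join_order H v t H' s :
  clique_join H v t H' -> clique_order H s -> open_vertex H s v ->
  exists s', [/\ clique_order H' s', {subset s <= s'} &
    forall v', v' != v -> open_vertex H s v' -> open_vertex H' s' v'].
Proof.
case=> vH le_2t [U [cardU disU EV EE]] [Us Hs consec jump] [vs nojump succ].
have Ev : s = take (index v s) s ++ v :: drop (index v s).+1 s.
  by rewrite -{1}[s](cat_take_drop (index v s)) (drop_nth v) ?index_mem ?nth_index.
set s1 := take _ s in Ev; set s2 := drop _ s in Ev.
have UNs : {in enum U, forall x, x \notin s}.
  by move=> x; rewrite mem_enum => xU; rewrite -Hs (disjointFr disU).
pose s' := s1 ++ v :: enum U ++ s2.
have mems' x : (x \in s') = (x \in s) || (x \in U).
  rewrite [in RHS]Ev !(mem_cat, inE) mem_enum.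
  by case: (x \in s1) (x == v) (x \in U) (x \in s2) => [] [] [] [].
have {Us} [Us' [ids idU]] : uniq s' /\ [/\ {in s, forall x, index x s' =
         if index x s <= index v s then index x s else index x s + #|U|} &
      {in U, forall x, index v s < index x s' <= index v s + #|U|}].
  split.
    rewrite /s' -cat_rcons uniq_catCA cat_rcons -Ev cat_uniq enum_uniq Us andbT /=.
    by apply/hasPn => x xs; apply: contraL xs => /UNs.
  have := @index_insert s1 s2 v (enum U); rewrite -Ev -/s' => /(_ Us UNs)[ids idU].
  split=> x xs; first by rewrite ids // cardE.
  have xe : x \in enum U by rewrite mem_enum.
  rewrite idU // cardE; move: xe; rewrite -index_mem => lt_x.
  by rewrite addn1 addSn ltnS leq_addr /= -addnS leq_add2l.
have k_gt0 : 0 < #|U| by rewrite cardU; lia.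
have {ids} ids x : x \in s -> index x s <= index v s /\ index x s' = index x s \/
                      index v s < index x s /\ index x s' = index x s + #|U|.
  by move=> xs; rewrite (ids x xs); case: leqP; [left | right].
have inj x y : x \in s -> index x s = index y s -> x = y.
  by move=> xs E; apply: (index_inj x xs) => //; rewrite -index_mem -E index_mem.
have edgeS x y : edge H x y -> x \in s /\ y \in s.
  move=> xy; split; rewrite -Hs; first exact: edge_vertices xy.
  by rewrite edge_sym in xy; apply: edge_vertices xy.
have idW x : x \in v |: U -> index v s <= index x s' <= index v s + #|U|.
  case/setU1P=> [->|/idU]; last lia.
  by have := ids v vs; lia.
have edgeH' x y : edge H' x y -> edge H x y \/ [/\ x != y, x \in v |: U & y \in v |: U].
  by rewrite EE => /orP[|/and3P]; [left | right].
have HH' x y : edge H x y -> edge H' x y by rewrite EE => ->.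
have WH' x y : x != y -> x \in v |: U -> y \in v |: U -> edge H' x y.
  by rewrite EE => -> -> ->; rewrite orbT.
have UW x : x \in U -> x \in v |: U by move=> xU; rewrite inE xU orbT.
have vW : v \in v |: U by rewrite !inE eqxx.
have UnH x y : x \in U -> edge H x y = false.
  move=> xU; apply/negP => /edgeS[xs _]; have := UNs x.
  by rewrite mem_enum => /(_ xU)/negP.
have Unv x : x \in U -> x != v.
  by move=> xU; apply/eqP => E; have := UNs x; rewrite mem_enum E vs -E => /(_ xU).
have succ_s a b : a \in s -> b \in s -> index b s' = (index a s').+1 ->
    a != v /\ index b s = (index a s).+1.
  move=> /ids ida /ids idb E; split; last by clear -ida idb E; lia.
  by apply/eqP => Ea; subst a; clear -ida idb E k_gt0; lia.
have mono x y : x \in s -> y \in s -> (index x s' <= index y s') = (index x s <= index y s).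
  by move=> /ids idx /ids idy; clear -idx idy; lia.
have outW x : x \in s -> x != v ->
    index x s' < index v s \/ index v s + #|U| < index x s'.
  move=> xs nxv; have := ids x xs.
  have : index x s <> index v s by move=> E; case/eqP: nxv; apply: inj.
  by clear; lia.
have succ_U a b : a \in s -> b \in U -> index b s' = (index a s').+1 -> a = v.
  move=> a_s bU Eab; apply: inj => //; have := ids a a_s; have := idU b bU.
  by clear -Eab; lia.
exists s'; split.
- split=> //.
  + by move=> x; rewrite mems' EV inE Hs.
  + move=> a b; rewrite mems' => b_s Eab.
    have : a \in s'.
      rewrite -index_mem; apply: leq_trans (_ : index b s' <= _); first by rewrite Eab.
      exact: index_size.
    rewrite mems'; case/orP: b_s => [b_s|bU]; case/orP=> [a_s|aU].
    * have [nav E] := succ_s a b a_s b_s Eab.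
      case: (consec a b b_s E) => [ab|[u [ua ub cross]]]; first by left; apply: HH'.
      right; exists u; split; [exact: HH' | exact: HH' |].
      move=> x y /edgeH'[xy|[_ /idW xW /idW yW]]; last first.
        by have := outW a a_s nav; clear -xW yW Eab; lia.
      have [x_s y_s] := edgeS x y xy; rewrite !mono //; exact: cross.
    (* Here a is the last new vertex and b the old successor of v. Both are adjacent to v, and an
       edge crossing between them starts at v, since none passes over v. *)
    * have E : index b s = (index v s).+1.
        by have := ids b b_s; have := idU a aU; clear -Eab; lia.
      right; exists v; split.
      - by apply: WH' => //; [rewrite eq_sym; apply: Unv | apply: UW].
      - exact: HH' (succ b b_s E).
      move=> x y /edgeH'[xy|[_ /idW xW /idW yW]]; last first.
        by have := ids b b_s; clear -xW yW E k_gt0; lia.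
      have [x_s y_s] := edgeS x y xy; rewrite [index b s' <= _]mono // => lx ly.
      left; apply: inj => //.
      have := nojump x y xy; have := ids x x_s; have := idU a aU.
      by clear -lx ly E Eab k_gt0; lia.
    * by left; rewrite (succ_U a b a_s bU Eab); apply: WH' => //;
        [rewrite eq_sym; apply: Unv | apply: UW].
    * left; apply: WH'; [|exact: UW|exact: UW]; apply: contra_eq_neq Eab => ->; clear; lia.
  + move=> x y m; rewrite mems' => /orP[m_s|mU] xy lxm lmy; last first.
      move=> c d /edgeH'[|[_ _ cW]]; first by rewrite UnH.
      move=> /edgeH'[|[_ _ dW]]; first by rewrite UnH.
      by move=> ncd; apply: WH'.
    (* The case m = v is vacuous, as no edge passes over v. *)
    have [Em|nmv] := eqVneq m v.
      subst m; have := ids v vs; case: (edgeH' x y xy) => [{}xy|[_ /idW xW /idW yW]]; last first.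
        by clear -xW yW lxm lmy; lia.
      have [x_s y_s] := edgeS x y xy; have := nojump x y xy.
      by move: lxm lmy; rewrite !ltnNge !mono // -!ltnNge; clear; lia.
    case: (edgeH' x y xy) => [{}xy|[_ /idW xW /idW yW]]; last first.
      by have := outW m m_s nmv; clear -xW yW lxm lmy; lia.
    have [x_s y_s] := edgeS x y xy; move: lxm lmy; rewrite !ltnNge !mono // -!ltnNge => lxm lmy.
    have nmW : m \notin v |: U.
      rewrite !inE negb_or nmv; apply/negP => mU; have := UNs m.
      by rewrite mem_enum m_s => /(_ mU).
    move=> c d /edgeH'[mc|[_ mW]]; last by rewrite mW in nmW.
    move=> /edgeH'[md|[_ mW]]; last by rewrite mW in nmW.
    by move=> ncd; apply: HH'; apply: (jump x y m).
- by move=> x xs; rewrite mems' xs.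
- move=> u nuv [us nojumpu succu]; split.
  + by rewrite mems' us.
  + move=> x y /edgeH'[xy|[_ /idW xW /idW yW]]; last first.
      by have := outW u us nuv; clear -xW yW; lia.
    have [x_s y_s] := edgeS x y xy; rewrite ltnNge !mono // -ltnNge; exact: nojumpu.
  + move=> b; rewrite mems' => /orP[b_s|bU] Eub.
      by have [_ E] := succ_s u b us b_s Eub; apply: HH'; apply: succu.
    by case/eqP: nuv; apply: (succ_U u b).
Qed.

Lemma clique_joins_order H vt G s : clique_joins H vt G -> clique_order H s ->
  uniq (unzip1 vt) -> {in unzip1 vt, forall v, open_vertex H s v} ->
  exists s', clique_order G s'.
Proof.
elim: vt H s => [|[v t] vt IHvt] H s /=.
  move=> [EV EE] [Us Hs consec jump] _ _; exists s; split=> //.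
  - by rewrite -EV.
  - move=> a b b_s /(consec a b b_s)[ab|[v [va vb cross]]]; first by left; rewrite -EE.
    by right; exists v; split; rewrite -?EE // => x y; rewrite -EE; apply: cross.
  - move=> x y m m_s; rewrite -EE => xy l1 l2 c d; rewrite -!EE.
    exact: jump xy l1 l2 c d.
case=> H' join joins order /andP[nv Uvt] op.
have [|s' [order' _ op']] := clique_join_order join order; first by apply: op; rewrite mem_head.
apply: (IHvt H' s') => // u uvt; apply: op'; last by apply: op; rewrite inE uvt orbT.
by apply: contraNneq nv => <-.
Qed.

Lemma pendant_cliques_order G : pendant_cliques G -> exists s, clique_order G s.
Proof.
case=> P [vt [pathP Uvt sub joins]].
have [s [order op]] := path_clique_order pathP.
by apply: (clique_joins_order joins order Uvt) => v /sub; apply: op.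
Qed.

End CliqueOrder.

(** * Minimal primes of binomial edge ideals *)

Section LocalGenerators.
Local Open Scope ring_scope.
Local Open Scope classical_set_scope.
Variables (k : fieldType) (n : nat) (G : sgraph 'I_n).
Local Notation S := {mpoly k[n + n]}.
Local Notation J := (binomial_edge_ideal k G).
Implicit Types (K P : set S) (a b c d u v : 'I_n) (s : seq 'I_n).

Definition xvar v : S := 'X_(lshift n v).
Definition yvar v : S := 'X_(rshift n v).

Lemma edge_binomialE a b :
  edge_binomial k a b = xvar a * yvar b - yvar a * xvar b.
Proof. by []. Qed.

Lemma edge_binomial_in a b : edge G a b -> J (edge_binomial k a b).
Proof. by move=> ab; apply: sub_ideal_gen; exists a, b. Qed.

Lemma edge_binomial_diag a : edge_binomial k a a = 0.
Proof. by rewrite edge_binomialE mulrC subrr. Qed.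

Lemma plucker a b c :
  xvar b * edge_binomial k a c =
    xvar a * edge_binomial k b c + xvar c * edge_binomial k a b /\
  yvar b * edge_binomial k a c =
    yvar a * edge_binomial k b c + yvar c * edge_binomial k a b.
Proof.
rewrite !edge_binomialE; move: (xvar a) (xvar b) (xvar c) (yvar a) (yvar b) (yvar c).
by move=> *; split; ring.
Qed.

Section Deformation.
Variable delta : 'I_(n + n) -> S.

Definition deformed_var (i : 'I_(n + n)) : {poly S} := ('X_i)%:P + (delta i)%:P * 'X.

Definition deformation : S -> {poly S} :=
  mmap (polyC \o @mpolyC (n + n) k) deformed_var.

HB.instance Definition _ := GRing.RMorphism.on deformation.

Lemma deformationX (i : 'I_(n + n)) : deformation 'X_i = deformed_var i.
Proof. by rewrite /deformation mmapX mmap1U. Qed.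

Lemma deformation0 F : (deformation F)`_0 = F.
Proof.
rewrite -horner_coef0 -[_.[0]]/(horner_eval 0 _) [in RHS](mpolyE F).
rewrite /deformation /mmap rmorph_sum; apply: eq_bigr => m _.
rewrite rmorphM /= /horner_eval hornerC mul_mpolyC; congr (_ *: _).
rewrite -[LHS]/(horner_eval 0 _) /mmap1 rmorph_prod mpolyXE_id.
apply: eq_bigr => i _; rewrite rmorphXn; congr (_ ^+ _).
by rewrite /= /horner_eval hornerD hornerC hornerM hornerX mulr0 addr0.
Qed.

(** The derivative of the binomial in the direction [delta], that is, the coefficient of t in its
    deformation. *)
Definition polar_binomial a b : S :=
  xvar a * delta (rshift n b) + delta (lshift n a) * yvar b
  - (yvar a * delta (lshift n b) + delta (rshift n a) * xvar b).

Definition deformed_binomial a b : S :=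
  delta (lshift n a) * delta (rshift n b) - delta (rshift n a) * delta (lshift n b).

Lemma deformation_binomial a b : deformation (edge_binomial k a b) =
  (edge_binomial k a b)%:P + (polar_binomial a b)%:P * 'X
  + (deformed_binomial a b)%:P * 'X^2.
Proof.
have dx v : deformation (xvar v) = (xvar v)%:P + (delta (lshift n v))%:P * 'X.
  exact: deformationX.
have dy v : deformation (yvar v) = (yvar v)%:P + (delta (rshift n v))%:P * 'X.
  exact: deformationX.
rewrite edge_binomialE rmorphB !rmorphM /= !dx !dy /polar_binomial /deformed_binomial.
rewrite !(rmorphB, rmorphD, rmorphM) /=.
move: (xvar a) (xvar b) (yvar a) (yvar b) (delta _) (delta _) (delta _) (delta _) => *.
by ring.
Qed.

(** A deformed binomial has degree at most 2 in t, so J moves inside P once the coefficients of t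
    and t^2 lie in P for all edges. The conclusion reads off the coefficient of t for other elements
    of P. *)
Lemma minimal_prime_tangent P : minimal_prime J P ->
  (forall a b, edge G a b -> P (polar_binomial a b) /\ P (deformed_binomial a b)) ->
  (forall i : 'I_(n + n), P 'X_i -> P (delta i)) /\
  (forall a b, P (edge_binomial k a b) -> P (polar_binomial a b)).
Proof.
move=> mP HP; have [[iP _ _] sJP _] := mP; have [P0 PD PM] := iP.
have JP F : J F -> forall l, P (deformation F)`_l.
  apply: (@ideal_gen_sub _ _ [set F | forall l, P (deformation F)`_l]).
    split=> [l|F' H PF PH l|H F' PF l];
      rewrite ?rmorph0 ?coef0 ?rmorphD ?coefD ?rmorphM ?coefM //.
      exact: (PD _ _ (PF l) (PH l)).
    by apply: ideal_sum => // r _; apply: PM.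
  move=> _ [a [b [ab ->]]] l; rewrite deformation_binomial !coefD coefC coefCM coefX coefCM coefXn.
  have [Pab1 Pab2] := HP a b ab; have Pab := sJP _ (edge_binomial_in ab).
  apply: (PD _ _ (PD _ _ _ _) _); first by case: eqP.
    by case: eqP; rewrite ?mulr1 ?mulr0.
  by case: eqP; rewrite ?mulr1 ?mulr0.
have tangent := minimal_prime_deformation mP deformation0 JP.
split=> [i Pi|a b Pab].
  have := tangent _ Pi 1%N; rewrite /= deformationX coefD coefC coefCM coefX.
  by rewrite add0r mulr1.
have := tangent _ Pab 1%N.
by rewrite /= deformation_binomial !coefD coefC coefCM coefX coefCM coefXn add0r mulr1 mulr0 addr0.
Qed.

End Deformation.

Section MinimalPrime.
Variable P : set S.
Hypothesis mP : minimal_prime J P.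

Definition vanishing v : bool := `[< P (xvar v) /\ P (yvar v) >].

Let pP : prime_ideal P. Proof. by case: mP. Qed.
Let iP : is_ideal P. Proof. by case: pP. Qed.
Let sJP : J `<=` P. Proof. by case: mP. Qed.

(** By the Plücker relations x_b f_ac and y_b f_ac lie in K, and one of x_b, y_b is a unit at P. *)
Lemma local_through K a b c : is_ideal K -> ~~ vanishing b ->
  K (edge_binomial k a b) -> K (edge_binomial k b c) ->
  local_ideal P K (edge_binomial k a c).
Proof.
move=> [K0 KD KM] /asboolPn/not_andP nb Kab Kbc; have [Ex Ey] := plucker a b c.
case: nb => nb; [exists (xvar b)|exists (yvar b)] => //; rewrite ?Ex ?Ey;
  by apply: KD; apply: KM.
Qed.

Lemma local_prime F : local_ideal P P F -> P F.
Proof. by case: pP => _ _ PM [s nPs /PM[]]. Qed.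

(** Otherwise the neighbours of v are pairwise proportional modulo P, and moving v in their common
    direction keeps J inside P. Then x_v and y_v in P force this direction into P, although it was
    chosen nonzero modulo P. *)
Lemma vanishing_neighbours v : vanishing v -> exists c d,
  [/\ edge G v c, edge G v d & ~ P (edge_binomial k c d)].
Proof.
move=> /asboolP[Pxv Pyv]; apply: contrapT => none.
have Pnb c d : edge G v c -> edge G v d -> P (edge_binomial k c d).
  by move=> vc vd; apply: contrapT => nP; apply: none; exists c, d.
have [P0 PD PM] := iP.
(* The direction is given by a non-vanishing neighbour, or is (1, 1) if all neighbours vanish. *)
have [be [ga [nbg Pbg]]] : exists be ga, ~ (P be /\ P ga) /\
    forall d, edge G v d -> P (be * yvar d - ga * xvar d).
  have [[c [vc nTc]]|all_van] := pselect (exists c, edge G v c /\ ~~ vanishing c).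
    exists (xvar c), (yvar c); split; first exact/asboolPn.
    by move=> d vd; apply: Pnb.
  exists 1, 1; split; first by case: pP => _ nP1 _ [].
  move=> d vd; have /asboolP[Pxd Pyd] : vanishing d.
    by apply/negPn/negP => nTd; apply: all_van; exists d.
  by apply: idealB => //; apply: PM.
pose delta (i : 'I_(n + n)) : S :=
  if i == lshift n v then be else if i == rshift n v then ga else 0.
have deltax a : delta (lshift n a) = if a == v then be else 0.
  by rewrite /delta (inj_eq (@lshift_inj _ _)) eq_lrshift.
have deltay a : delta (rshift n a) = if a == v then ga else 0.
  by rewrite /delta (inj_eq (@rshift_inj _ _)) eq_rlshift.
have [tan _] : (forall i : 'I_(n + n), P 'X_i -> P (delta i)) /\
    (forall a b, P (edge_binomial k a b) -> P (polar_binomial delta a b)).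
  apply: (minimal_prime_tangent mP) => a b ab.
  rewrite /polar_binomial /deformed_binomial !deltax !deltay.
  have [Ea|nav] := eqVneq a v; have [Eb|nbv] := eqVneq b v.
  - by rewrite Ea Eb edge_irr in ab.
  - rewrite !mulr0 add0r subrr; split=> //; rewrite add0r.
    by apply: Pbg; rewrite -Ea.
  - rewrite !mul0r !addr0 subrr; split=> //.
    rewrite mulrC [yvar a * _]mulrC -opprB -mulN1r; apply: PM; apply: Pbg.
    by rewrite -Eb edge_sym.
  - by rewrite !mulr0 !mul0r !addr0 subrr.
apply: nbg; split.
  by have := tan _ Pxv; rewrite deltax eqxx.
by have := tan _ Pyv; rewrite deltay eqxx.
Qed.

(* Shearing the vertices of B against the others deforms only the binomials of
   the edges that cross B. *)
Lemma minimal_prime_cut (B : pred 'I_n) a b :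
  (forall c d, edge G c d -> ~~ B c -> B d -> vanishing c || vanishing d) ->
  ~~ B a -> B b -> ~~ vanishing a -> ~~ vanishing b -> ~ P (edge_binomial k a b).
Proof.
move=> cross nBa Bb /asboolPn nTa /asboolPn nTb Pab.
have [P0 PD PM] := iP; have [_ _ Pprime] := pP.
have cross2 c d : edge G c d -> B c != B d ->
    P (xvar c * xvar d) /\ P (yvar c * yvar d).
  move=> cd neB; have : vanishing c || vanishing d.
    case Bc: (B c) neB; case Bd: (B d) => // _; last by apply: cross; rewrite ?Bc.
    by rewrite orbC; apply: cross; rewrite ?Bd // edge_sym.
  case/orP=> /asboolP[Px Py]; split; try (by apply: PM);
    by rewrite mulrC; apply: PM.
(* The shear y_c + t x_c for c in B changes f_cd by t x_c x_d, up to sign, if exactly one of c, d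
   lies in B, and not at all otherwise. *)
have Pxx : P (xvar a * xvar b).
  pose delta (i : 'I_(n + n)) : S :=
    match split i with inl _ => 0 | inr c => if B c then xvar c else 0 end.
  have deltax c : delta (lshift n c) = 0 by rewrite /delta (unsplitK (inl c)).
  have deltay c : delta (rshift n c) = if B c then xvar c else 0.
    by rewrite /delta (unsplitK (inr c)).
  have [_ tan] : (forall i : 'I_(n + n), P 'X_i -> P (delta i)) /\
      (forall a b, P (edge_binomial k a b) -> P (polar_binomial delta a b)).
    apply: (minimal_prime_tangent mP) => c d cd.
    rewrite /polar_binomial /deformed_binomial !deltax !deltay !mul0r !mulr0 subrr addr0 add0r.
    split=> //; have := cross2 c d cd.
    case Bc: (B c); case Bd: (B d);
      rewrite ?mulr0 ?mul0r ?subrr ?subr0 ?sub0r //;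
      move=> /(_ isT)[Pcd _] //.
    by rewrite -mulN1r; apply: PM.
  have := tan _ _ Pab; rewrite /polar_binomial !deltax !deltay Bb (negPf nBa).
  by rewrite !mul0r mulr0 !addr0 subr0.
(* The same with the shear x_c + t y_c. *)
have Pyy : P (yvar a * yvar b).
  pose delta (i : 'I_(n + n)) : S :=
    match split i with inl c => if B c then yvar c else 0 | inr _ => 0 end.
  have deltax c : delta (lshift n c) = if B c then yvar c else 0.
    by rewrite /delta (unsplitK (inl c)).
  have deltay c : delta (rshift n c) = 0 by rewrite /delta (unsplitK (inr c)).
  have [_ tan] : (forall i : 'I_(n + n), P 'X_i -> P (delta i)) /\
      (forall a b, P (edge_binomial k a b) -> P (polar_binomial delta a b)).
    apply: (minimal_prime_tangent mP) => c d cd.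
    rewrite /polar_binomial /deformed_binomial !deltax !deltay !mul0r !mulr0 subrr addr0 add0r.
    split=> //; have := cross2 c d cd.
    case Bc: (B c); case Bd: (B d);
      rewrite ?mulr0 ?mul0r ?subrr ?subr0 ?sub0r //;
      move=> /(_ isT)[_ Pcd] //.
    by rewrite -mulN1r; apply: PM.
  have := tan _ _ Pab; rewrite /polar_binomial !deltax !deltay Bb (negPf nBa).
  rewrite !mul0r mulr0 !addr0 add0r => PN; rewrite -[_ * _]opprK -mulN1r; exact: PM.
have Pxy : P (xvar a * yvar b) -> P (yvar a * xvar b).
  by move=> Pxy; rewrite -[_ * _](subKr (xvar a * yvar b)); apply: idealB.
have Pyx : P (yvar a * xvar b) -> P (xvar a * yvar b).
  by move=> Pyx; rewrite -[_ * _](subrK (yvar a * xvar b)); apply: PD.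
(* As P is prime and contains f_ab, the two products in P force a or b to vanish. *)
have [Pxa|Pxb] := Pprime _ _ Pxx.
  have /Pprime[Pya|Pxb] : P (yvar a * xvar b) by apply: Pxy; apply: idealM.
    by apply: nTa.
  have [Pya|Pyb] := Pprime _ _ Pyy; [exact: nTa | exact: nTb].
have /Pprime[Pxa|Pyb] : P (xvar a * yvar b) by apply: Pyx; apply: PM.
  have [Pya|Pyb] := Pprime _ _ Pyy; [exact: nTa | exact: nTb].
exact: nTb.
Qed.

End MinimalPrime.
End LocalGenerators.

Lemma size_spanning_ord n (w : seq 'I_n) :
  uniq w -> (forall v, v \in w) -> size w = n.
Proof.
move=> Uw wT; apply: etrans (size_enum_ord n); apply: perm_size.
by apply: uniq_perm; rewrite ?enum_uniq // => v; rewrite wT mem_enum.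
Qed.

(** * Local generators read off from the ordering *)

Section OrderedGenerators.
Local Open Scope ring_scope.
Local Open Scope classical_set_scope.
Variables (k : fieldType) (n : nat) (G : sgraph 'I_n).
Local Notation S := {mpoly k[n + n]}.
Local Notation J := (binomial_edge_ideal k G).
Local Notation f := (edge_binomial k).
Local Notation x := (xvar k).
Local Notation y := (yvar k).
Implicit Types (P : set S) (a b c d m u v : 'I_n) (s : seq 'I_n).

Fixpoint binomial_chain a s : S :=
  if s is b :: s' then f a b * binomial_chain b s' else x a.

(** The product D for the ordering [a :: s]. *)
Definition order_product a s : S := y a * binomial_chain a s.

Variables (v0 : 'I_n) (s0 w : seq 'I_n).
Hypotheses (Ew : w = v0 :: s0) (ordG : clique_order G w) (wT : forall v, v \in w).

Variable P : set S.
Hypothesis mP : minimal_prime J P.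
Local Notation T := (vanishing P).

Definition linked a b : bool := [&& ~~ T a, ~~ T b & `[< P (f a b) >]].

Definition order_generators : seq S :=
  [seq x v | v <- w & T v] ++ [seq y v | v <- w & T v] ++
  [seq f ab.1 ab.2 | ab <- zip w s0 & linked ab.1 ab.2].
Local Notation z := order_generators.

Let pP : prime_ideal P. Proof. by case: mP. Qed.
Let iP : is_ideal P. Proof. by case: pP. Qed.
Let sJP : J `<=` P. Proof. by case: mP. Qed.
Let iJ : is_ideal J. Proof. exact: ideal_gen_ideal. Qed.
Let Uw : uniq w. Proof. by case: ordG. Qed.

Let mem_zip a b : ((a, b) \in zip w s0) = (b \in s0) && (index b w == (index a w).+1).
Proof. by rewrite Ew mem_zip_behead -?Ew. Qed.

Lemma edge_binomial_oppP (K : set S) a b : is_ideal K -> K (f a b) -> K (f b a).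
Proof. by move=> [_ _ KM] Kab; rewrite edge_binomialC -mulN1r; apply: KM. Qed.

(** The two neighbours c, d that a vanishing vertex would provide are adjacent here, so f_cd lies in
    P. *)
Lemma simplicial_not_vanishing v : simplicial G v -> ~~ T v.
Proof.
move=> simp; apply/negP => /(vanishing_neighbours mP)[c [d [vc vd []]]].
have [<-|ncd] := eqVneq c d; first by rewrite edge_binomial_diag; case: iP.
by apply: sJP; apply: edge_binomial_in; apply: simp.
Qed.

(** If a b is not an edge, the common neighbour p of a and b is an end of u v, because u v crosses
    the gap between them. So p does not vanish, and f_ab follows from f_ap and f_pb. *)
Lemma consecutive_linked u v a b : edge G u v ->
  (index u w <= index a w)%N -> index b w = (index a w).+1 ->
  (index b w <= index v w)%N -> ~~ T u -> ~~ T v -> ~~ T a -> ~~ T b ->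
  linked a b.
Proof.
move=> uv ua Eab bv nTu nTv nTa nTb; rewrite /linked nTa nTb; apply/asboolP.
have [_ _ consec _] := ordG.
have [ab|[p [pa pb cross]]] := consec a b (wT b) Eab.
  by apply: sJP; apply: edge_binomial_in.
have nTp : ~~ T p by case: (cross u v uv ua bv) => <-.
apply: (local_prime mP); apply: (local_through iP nTp).
  by apply: edge_binomial_oppP => //; apply: sJP; apply: edge_binomial_in.
by apply: sJP; apply: edge_binomial_in.
Qed.

Lemma linked_generator a b : index b w = (index a w).+1 -> linked a b ->
  f a b \in z.
Proof.
move=> Eab ab; rewrite !mem_cat; apply/orP; right; apply/orP; right.
apply/mapP; exists (a, b) => //; rewrite mem_filter ab mem_zip.
rewrite Eab eqxx andbT; have := wT b; rewrite [in X in X -> _]Ew inE => /predU1P[Eb|//].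
by move: Eab; rewrite Eb Ew /= eqxx.
Qed.

Lemma vanishing_generator v : T v -> x v \in z /\ y v \in z.
Proof.
move=> Tv; rewrite !mem_cat.
by split; apply/orP; [left | right; apply/orP; left]; apply: map_f; rewrite mem_filter Tv wT.
Qed.

(** For an edge u v with non-vanishing ends, the vertices strictly between are simplicial and so do
    not vanish. All consecutive binomials from u to v are then generators, and Plücker relations
    combine them into f_uv. *)
Lemma local_order_generators : J `<=` local_ideal P (gen_pow z 1).
Proof.
have iL := local_ideal_ideal pP (gen_pow_ideal z 1); have [L0 LD LM] := iL.
have [Z0 ZD ZM] := gen_pow_ideal z 1.
have sL := sub_local_ideal (I := gen_pow z 1) pP.
apply: ideal_gen_sub => // _ [u [v [uv ->]]].
have [/orP Tuv|] := boolP (T u || T v).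
  apply: sL; rewrite edge_binomialE.
  case: Tuv => /vanishing_generator[/gen_pow1 zx /gen_pow1 zy].
    by apply: (idealB (gen_pow_ideal z 1)); rewrite mulrC; apply: ZM.
  by apply: (idealB (gen_pow_ideal z 1)); apply: ZM.
rewrite negb_or => /andP[nTu nTv].
wlog lt_uv : u v uv nTu nTv / (index u w < index v w)%N.
  move=> Huv; have [/Huv|lt_vu|E] := ltngtP (index u w) (index v w); first exact.
    apply: edge_binomial_oppP => //; apply: Huv => //; by rewrite edge_sym.
  have Eab : u = v by apply: (index_inj u (wT u) (wT v)).
  by move: uv; rewrite Eab edge_irr.
have [_ _ _ jump] := ordG.
suff chain l b : index b w = (index u w + l.+1)%N -> (index b w <= index v w)%N ->
    ~~ T b /\ local_ideal P (gen_pow z 1) (f u b).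
  have Ev : index v w = (index u w + (index v w - (index u w).+1).+1)%N by clear -lt_uv; lia.
  by case: (chain _ v Ev (leqnn _)).
elim: l b => [|l IHl] b Eb le_bv.
  have nTb : ~~ T b.
    have [Ebv|ltbv] := eqVneq (index b w) (index v w).
      by have -> : b = v by apply: (index_inj u (wT b) (wT v)).
    have lt1 : (index u w < index b w)%N by clear -Eb; lia.
    have lt2 : (index b w < index v w)%N by clear -ltbv le_bv; lia.
    exact: simplicial_not_vanishing (jump u v b (wT b) uv lt1 lt2).
  have E1 : index b w = (index u w).+1 by rewrite Eb addn1.
  split=> //; apply: sL; apply: gen_pow1; apply: (linked_generator E1).
  exact: (consecutive_linked uv (leqnn _) E1 le_bv nTu nTv nTu nTb).
have nTb : ~~ T b.
  have [Ebv|ltbv] := eqVneq (index b w) (index v w).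
    by have -> : b = v by apply: (index_inj u (wT b) (wT v)).
  have lt1 : (index u w < index b w)%N by clear -Eb; lia.
  have lt2 : (index b w < index v w)%N by clear -ltbv le_bv; lia.
  exact: simplicial_not_vanishing (jump u v b (wT b) uv lt1 lt2).
split=> //; pose a := nth v0 w (index u w + l.+1).
have Ea : index a w = (index u w + l.+1)%N.
  by rewrite index_uniq //; have := wT b; rewrite -index_mem; clear -Eb; lia.
have Eab : index b w = (index a w).+1 by rewrite Eb Ea addnS.
have [|nTa La] := IHl a Ea; first by rewrite ltnW // -Eab.
apply: local_idealK => //; apply: (local_through iL nTa) => //.
apply: sL; apply: gen_pow1; apply: (linked_generator Eab).
by apply: (consecutive_linked uv _ Eab le_bv nTu nTv nTa nTb); rewrite Ea leq_addr.
Qed.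

(** For a vanishing v with neighbours c, d as above, f_cd x_v and f_cd y_v lie in J and f_cd is a
    unit at P. A linked pair is an edge or is joined through a common neighbour p. *)
Lemma order_generators_local : {in z, forall F, local_ideal P J F}.
Proof.
have [J0 JD JM] := iJ; have [_ _ consec _] := ordG.
have vanish v : T v -> local_ideal P J (x v) /\ local_ideal P J (y v).
  move=> /(vanishing_neighbours mP)[c [d [vc vd nPcd]]].
  have Jvc := edge_binomial_in (k := k) vc; have Jvd := edge_binomial_in (k := k) vd.
  have [Ex Ey] := plucker k c v d.
  have Jcv := edge_binomial_oppP iJ Jvc.
  split; [exists (f c d) => //; rewrite mulrC Ex | exists (f c d) => //; rewrite mulrC Ey];
    by apply: JD; apply: JM.
move=> F; rewrite !mem_cat => /orP[|/orP[]] /mapP[].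
- by move=> v; rewrite mem_filter => /andP[/vanish[]] ? ? _ ->.
- by move=> v; rewrite mem_filter => /andP[/vanish[]] ? ? _ ->.
move=> [a b]; rewrite mem_filter mem_zip /= =>
  /and3P[/and3P[nTa nTb /asboolP Pab] bs /eqP Eab] ->.
have [ab|[p [pa pb cross]]] := consec a b (wT b) Eab.
  exact: (sub_local_ideal pP (edge_binomial_in ab)).
have [Tp|nTp] := boolP (T p); last first.
  apply: (local_through iJ nTp); last exact: edge_binomial_in.
  exact: (edge_binomial_oppP iJ (edge_binomial_in pa)).
(* If p vanishes, every edge crossing the cut between a and b has p as an end, so f_ab cannot lie in
   P. *)
exfalso; have Bb : (index b w <= index b w)%N by [].
apply: (@minimal_prime_cut k n G P mP (fun c => index b w <= index c w)%N
          a b _ _ Bb nTa nTb) => //.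
  move=> c d cd; rewrite -ltnNge Eab ltnS => lc; rewrite -Eab => ld.
  by case: (cross c d cd lc ld) => ->; rewrite Tp ?orbT.
by rewrite Eab ltnn.
Qed.

(** A crude bound, but independent of P, so that one q serves all minimal primes. *)
Lemma size_order_generators : (size z <= 3 * n)%N.
Proof.
have szw := size_spanning_ord Uw wT.
rewrite !size_cat !size_map !size_filter.
have := count_size T w; have := count_size (fun ab : 'I_n * 'I_n => linked ab.1 ab.2) (zip w s0).
rewrite size_zip szw => c1 c2; have : (minn n (size s0) <= n)%N by rewrite geq_minl.
by move: c1 c2; set c1 := count _ _; set c2 := count _ _; lia.
Qed.

(** Each vertex occurs in two factors of D, so a vanishing one contributes 2 to the degree, as many
    as it has generators; a linked pair contributes 1 through its own binomial. *)
Lemma order_product_gen_pow : gen_pow z (size z) (order_product v0 s0).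
Proof.
have [Z0 ZD ZM] := gen_pow_ideal z 1.
have zx v : gen_pow z (T v) (x v).
  have [Tv|_] := boolP (T v); last exact: gen_pow0.
  exact: gen_pow1 (proj1 (vanishing_generator Tv)).
have zy v : gen_pow z (T v) (y v).
  have [Tv|_] := boolP (T v); last exact: gen_pow0.
  exact: gen_pow1 (proj2 (vanishing_generator Tv)).
have zf a b : (a, b) \in zip w s0 -> gen_pow z (T a + T b + linked a b) (f a b).
  rewrite mem_zip => /andP[bs /eqP Eab].
  have [ab|nab] := boolP (linked a b).
    have := gen_pow1 (linked_generator Eab ab); move: ab; rewrite /linked.
    by case/and3P=> /negPf-> /negPf->.
  rewrite addn0 edge_binomialE; apply: (idealB (gen_pow_ideal _ _)).
    exact: gen_powD.
  exact: gen_powD.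
have chain a s : {subset zip (a :: s) s <= zip w s0} ->
    gen_pow z (T a + 2 * count T s + count (fun ab => linked ab.1 ab.2) (zip (a :: s) s))
      (binomial_chain a s).
  elim: s a => [|b s IHs] a sub; first by rewrite /= muln0 !addn0.
  have zab : gen_pow z (T a + T b + linked a b) (f a b).
    by apply: zf; apply: sub; rewrite /= mem_head.
  have zbs := IHs b (fun ab abs => sub ab (mem_behead (s := zip [:: a, b & s] (b :: s)) abs)).
  by apply: gen_powS (gen_powD zab zbs) => /=; lia.
apply: gen_powS (gen_powD (zy v0) (chain v0 s0 _)); last by rewrite Ew.
rewrite !size_cat !size_map !size_filter Ew /=.
have -> : count [eta T] s0 = count T s0 by [].
by clear; lia.
Qed.

End OrderedGenerators.

(** * The splitting map of an edge binomial *)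

Section MinorChain.
Local Open Scope ring_scope.
Variable I : eqType.
Implicit Types (a b : I) (s : seq I).

Fixpoint minor_chain_rec (A : comNzRingType) (X Y : I -> A) a s : A :=
  if s is b :: s' then (X a * Y b - Y a * X b) * minor_chain_rec X Y b s' else X a.

(** The shape of [order_product] over an arbitrary ring, to be applied to images under the weight
    map. *)
Definition minor_chain (A : comNzRingType) (X Y : I -> A) a s : A :=
  Y a * minor_chain_rec X Y a s.

Lemma lead_coef_minor (A : idomainType) (c d c' d' : A) i j :
  (i < j)%N -> c != 0 -> d != 0 ->
  lead_coef (c%:P * (d%:P * 'X^j) - d'%:P * 'X^i * c'%:P) = c * d.
Proof.
move=> lt_ij c0 d0; rewrite mulrA -polyCM mulrAC -polyCM; set u := c * d.
have u0 : u != 0 by rewrite mulf_neq0.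
rewrite lead_coefDl; first by rewrite lead_coefM lead_coefC lead_coefXn mulr1.
rewrite size_polyN size_mulXn ?polyC_eq0 // size_polyC u0 addn1 ltnS.
rewrite (leq_trans (size_polyMleq _ _)) // size_polyXn size_polyC addnS /=.
by case: eqP => _ /=; lia.
Qed.

Lemma lead_coef_proper_expM (A : nzSemiRingType) (D F H : {poly A}) (d u v w : A) N :
  lead_coef D = d -> lead_coef F = u -> lead_coef H = v ->
  d ^+ N * (u * v) = w -> w != 0 -> lead_coef (D ^+ N * (F * H)) = w.
Proof.
move=> lD lF lH <- nz; have nzFH : lead_coef F * lead_coef H != 0.
  by apply: contraNneq nz; rewrite lF lH => ->; rewrite mulr0.
have nzD : d ^+ N != 0 by apply: contraNneq nz => ->; rewrite mul0r.
have lDN : lead_coef (D ^+ N) = d ^+ N.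
  elim: N nzD {nz} => [|N IHN] nzD; first by rewrite !expr0 lead_coef1.
  have nzN : d ^+ N != 0 by apply: contraNneq nzD => E; rewrite exprS E mulr0.
  by rewrite !exprS lead_coef_proper_mul IHN // lD -exprS.
by rewrite lead_coef_proper_mul (lead_coef_proper_mul nzFH) lDN lF lH.
Qed.

(** In each minor the term X_a Y_b has the higher power of t, since positions increase. The outer
    factors Y and X supply the two variables left over at the ends. *)
Lemma lead_coef_minor_chain (A : idomainType) (X Y : I -> A)
    (WX WY : I -> {poly A}) (pos : I -> nat) a s :
  (forall v, WX v = (X v)%:P) -> (forall v, WY v = (Y v)%:P * 'X^(pos v)) ->
  (forall v, X v != 0) -> (forall v, Y v != 0) ->
  {in zip (a :: s) s, forall ab, (pos ab.1 < pos ab.2)%N} ->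
  lead_coef (minor_chain WX WY a s) = \prod_(v <- a :: s) (X v * Y v).
Proof.
move=> WXE WYE X0 Y0 lt_s; rewrite lead_coefM big_cons WYE lead_coefM lead_coefC.
rewrite lead_coefXn mulr1 [X a * _]mulrC -mulrA; congr (_ * _).
elim: s a lt_s => [|b s IHs] a lt_s /=.
  by rewrite WXE lead_coefC big_nil mulr1.
have lt_ab : (pos a < pos b)%N by apply: (lt_s (a, b)); rewrite /= mem_head.
rewrite lead_coefM !WXE !WYE (lead_coef_minor _ _ lt_ab) // IHs; last first.
  by move=> ab abs; apply: lt_s; rewrite /= inE abs orbT.
by rewrite big_cons -!mulrA; congr (_ * _); rewrite mulrCA.
Qed.

End MinorChain.

(** * Initial forms with respect to a weight *)

Section LeadingForm.
Local Open Scope ring_scope.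
Variables (k : fieldType) (N : nat) (omega : 'I_N -> nat).
Local Notation S := {mpoly k[N]}.

(** The leading coefficient in t of the image of F is the initial form of F for the weight
    [omega]. *)
Definition weight_map : S -> {poly S} :=
  mmap (polyC \o @mpolyC N k) (fun i => ('X_i)%:P * 'X^(omega i)).

HB.instance Definition _ := GRing.RMorphism.on weight_map.

Lemma weight_mapB : {morph weight_map : F H / F - H}. Proof. exact: rmorphB. Qed.
Lemma weight_mapM : {morph weight_map : F H / F * H}. Proof. exact: rmorphM. Qed.

Lemma weight_mapXn d F : weight_map (F ^+ d) = weight_map F ^+ d.
Proof.
elim: d => [|d IHd]; first exact: rmorph1.
by rewrite !exprS weight_mapM IHd.
Qed.

Lemma weight_mapX (m : 'X_{1..N}) :
  weight_map 'X_[m] = ('X_[m])%:P * 'X^(\sum_i m i * omega i).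
Proof.
rewrite /weight_map mmapX /mmap1 mpolyXE_id rmorph_prod.
rewrite (eq_bigr (fun i => ('X_i ^+ m i)%:P * 'X^(m i * omega i))) => [|i _].
  by rewrite big_split prodrXr.
by rewrite exprMn rmorphXn -exprM mulnC.
Qed.

Lemma coef_weight_map (F : S) (m : 'X_{1..N}) d :
  (weight_map F)`_d@_m = if (\sum_i m i * omega i == d)%N then F@_m else 0.
Proof.
rewrite /weight_map /mmap coef_sum raddf_sum /=.
have term u : (((F@_u)%:MP)%:P * mmap1 (fun i => ('X_i)%:P * 'X^(omega i)) u)`_d@_m =
    if (u == m) && (\sum_i u i * omega i == d)%N then F@_u else 0.
  have -> : mmap1 (fun i => ('X_i)%:P * 'X^(omega i)) u = weight_map 'X_[u].
    by rewrite /weight_map mmapX.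
  rewrite weight_mapX.
  rewrite mulrA -(rmorphM polyC) coefCM coefXn mulr_natr mcoeffMn mul_mpolyC.
  rewrite mcoeffZ mcoeffX [d == _]eq_sym.
  by case: eqP => _; case: eqP => _; rewrite ?mulr1 ?mulr0 ?mulr1n ?mulr0n.
rewrite (eq_bigr _ (fun u _ => term u)).
have [mF|mF] := boolP (m \in msupp F); last first.
  rewrite (memN_msupp_eq0 mF) if_same big_seq big1 // => u uF.
  by rewrite (negPf (memPn mF u uF)).
rewrite (bigD1_seq m) ?msupp_uniq //= eqxx [X in _ + X]big1 ?addr0 // => u.
by move/negPf->.
Qed.

Lemma mcoeff_weight_lead (F : S) (m : 'X_{1..N}) :
  lead_coef (weight_map F) = 'X_[m] -> F@_m = 1.
Proof.
move=> lF; have := coef_weight_map F m (size (weight_map F)).-1.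
rewrite -lead_coefE lF mcoeffX eqxx; case: ifP => // _ /eqP.
by rewrite oner_eq0.
Qed.

End LeadingForm.

(** * The initial monomial of D *)

Section OrderProduct.
Local Open Scope ring_scope.
Variables (k : fieldType) (n : nat).
Local Notation S := {mpoly k[n + n]}.
Local Notation f := (edge_binomial k).
Local Notation x := (@xvar k n).
Local Notation y := (@yvar k n).
Implicit Types (a b u v : 'I_n) (s : seq 'I_n).
Variable pos : 'I_n -> nat.

(** Under this weight x_a y_b is the initial term of f_ab whenever [pos a < pos b]. *)
Definition order_weight (i : 'I_(n + n)) : nat :=
  match split i with inl _ => 0 | inr v => pos v end.
Local Notation W := (weight_map (k := k) order_weight).

Lemma weight_map_xvar v : W (x v) = (x v)%:P.
Proof.
rewrite /weight_map mmapX mmap1U /order_weight (unsplitK (inl v)) /=.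
by rewrite expr0 mulr1.
Qed.

Lemma weight_map_yvar v : W (y v) = (y v)%:P * 'X^(pos v).
Proof. by rewrite /weight_map mmapX mmap1U /order_weight (unsplitK (inr v)). Qed.

Lemma weight_map_order_product a s :
  W (order_product k a s) = minor_chain (W \o x) (W \o y) a s.
Proof.
rewrite /order_product /minor_chain weight_mapM; congr (_ * _).
elim: s a => [|b s IHs] a //=; rewrite weight_mapM IHs; congr (_ * _).
by rewrite edge_binomialE weight_mapB !weight_mapM.
Qed.

Lemma lead_weight_order_product a s :
  {in zip (a :: s) s, forall ab, (pos ab.1 < pos ab.2)%N} ->
  lead_coef (W (order_product k a s)) = \prod_(v <- a :: s) (x v * y v).
Proof.
move=> lt_s; rewrite weight_map_order_product; apply: lead_coef_minor_chain => // v.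
- by rewrite /= weight_map_xvar.
- by rewrite /= weight_map_yvar.
- by rewrite -msupp_eq0 msuppX.
- by rewrite -msupp_eq0 msuppX.
- exact: lt_s.
Qed.

Lemma edge_binomial_homog a b : f a b \is 2.-homog.
Proof.
have X1 i : ('X_i : S) \is 1.-homog by rewrite dhomogX; apply/eqP; exact: mdeg1.
by apply: rpredB; apply: (dhomogM (d := 1) (e := 1)); apply: X1.
Qed.

Lemma order_product_homog a s : order_product k a s \is (2 * (size s).+1).-homog.
Proof.
have X1 i : ('X_i : S) \is 1.-homog by rewrite dhomogX; apply/eqP; exact: mdeg1.
have -> : (2 * (size s).+1 = 1 + (2 * size s).+1)%N by lia.
apply: dhomogM; first exact: X1.
elim: s a => [|b s IHs] a /=; first exact: X1.
have -> : ((2 * (size s).+1).+1 = 2 + (2 * size s).+1)%N by lia.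
by apply: dhomogM (IHs b); apply: edge_binomial_homog.
Qed.

Lemma homog_msize (F : S) d : F \is d.-homog -> (msize F <= d.+1)%N.
Proof.
move=> /dhomogP hF; rewrite msizeE; apply/bigmax_leqP_seq => m mF _.
by rewrite hF.
Qed.

Definition all_ones : 'X_{1..n + n} := [multinom 1%N | i < n + n].

Lemma prod_all_vars w : uniq w -> (forall v, v \in w) ->
  \prod_(v <- w) (x v * y v) = 'X_[all_ones].
Proof.
move=> Uw wT; rewrite mpolyXE_id big_split_ord big_split /=.
have perm_w : perm_eq w (index_enum 'I_n).
  by apply: uniq_perm; rewrite ?index_enum_uniq // => v; rewrite mem_index_enum wT.
by congr (_ * _); rewrite (perm_big _ perm_w); apply: eq_bigr => v _; rewrite mnmE.
Qed.

Lemma mdeg_all_ones : mdeg all_ones = (2 * n)%N.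
Proof.
rewrite mdegE (eq_bigr (fun=> 1%N)) => [|i _]; last by rewrite mnmE.
by rewrite sum1_card card_ord mul2n addnn.
Qed.

(** The monomial g: its product with x_a y_b is the product of all variables. *)
Definition cofactor_monomial a b : S :=
  'X_[all_ones - (U_(lshift n a) + U_(rshift n b))].

Lemma cofactor_le a b :
  (U_(lshift n a) + U_(rshift n b) <= all_ones)%MM.
Proof.
apply/mnm_lepP => i; rewrite mnmDE !mnm1E mnmE.
case: (splitP i) => j E; rewrite -!val_eqE /= E; case: eqP; case: eqP;
  by have := ltn_ord a; have := ltn_ord j; lia.
Qed.

(** The coefficient comes from multiplying initial forms, the size bound from F being homogeneous of
    degree 2n(N+1). *)
Lemma order_product_coefficient v0 s0 a b N :
  let w := v0 :: s0 in
  uniq w -> (forall v, v \in w) ->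
  {in zip w s0, forall ab, (pos ab.1 < pos ab.2)%N} -> (pos a < pos b)%N ->
  let F := order_product k v0 s0 ^+ N * (cofactor_monomial a b * f a b) in
  F@_(all_ones *+ N.+1) = 1 /\ (msize F <= (mdeg (all_ones *+ N.+1)).+1)%N.
Proof.
move=> w Uw wT lt_w lt_ab F.
split.
  apply: (mcoeff_weight_lead (omega := order_weight)).
  have lD : lead_coef (W (order_product k v0 s0)) = 'X_[all_ones].
    by rewrite lead_weight_order_product // prod_all_vars.
  have lf : lead_coef (W (f a b)) = x a * y b.
    rewrite edge_binomialE weight_mapB !weight_mapM !weight_map_xvar !weight_map_yvar.
    by apply: lead_coef_minor => //; rewrite -msupp_eq0 msuppX.
  have lc : lead_coef (W (cofactor_monomial a b)) =
      'X_[all_ones - (U_(lshift n a) + U_(rshift n b))].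
    by rewrite weight_mapX lead_coef_Mmonic ?monicXn // lead_coefC.
  rewrite {}/F; move: (order_product k v0 s0) (cofactor_monomial a b) (f a b) lD lf lc.
  move=> D c g lD lf lc; rewrite (weight_mapM order_weight (D ^+ N) (c * g)).
  rewrite (weight_mapM order_weight c g) weight_mapXn.
  apply: (lead_coef_proper_expM lD lc lf); last by rewrite -msupp_eq0 msuppX.
  have -> : x a * y b = 'X_[U_(lshift n a) + U_(rshift n b)] by rewrite mpolyXD.
  by rewrite -mpolyXD submK ?cofactor_le // -mpolyXn exprSr.
apply: homog_msize; rewrite mdegMn mdeg_all_ones mulnS.
have szw : (2 * n = 2 * (size s0).+1)%N by rewrite -[in LHS](size_spanning_ord Uw wT).
rewrite addnC; apply: dhomogM.
  by rewrite szw; apply: dhomogMn; apply: order_product_homog.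
rewrite -mdeg_all_ones -(submK (cofactor_le a b)) mdegD.
have -> : mdeg (U_(lshift n a) + U_(rshift n b))%MM = 2 by rewrite mdegD !mdeg1.
apply: dhomogM; last exact: edge_binomial_homog.
by rewrite /cofactor_monomial dhomogX.
Qed.

End OrderProduct.

(** * A map on S compatible with symbolic powers that sends f_ab to 1 *)

Section EdgeSplitting.
Local Open Scope ring_scope.
Variables (p : nat) (k : fieldType) (chk : p \in [pchar k]).
Variables (n : nat) (G : sgraph 'I_n).
Local Notation S := {mpoly k[n + n]}.
Local Notation J := (binomial_edge_ideal k G).

Lemma edge_splitting (tau : k -> k) w a b :
  root_linear p 1 tau -> tau 1 = 1 ->
  clique_order G w -> (forall v, v \in w) -> (index a w < index b w)%N ->
  exists e (Theta : S -> S), [/\ root_linear p e Theta,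
    forall m F, symbolic_pow J (m * p ^ e) F -> symbolic_pow J m (Theta F) &
    Theta (edge_binomial k a b) = 1].
Proof.
move=> ltau tau1 ordw wT lt_ab.
have p_gt1 : (1 < p)%N by rewrite prime_gt1 // (pcharf_prime chk).
have p_gt0 : (0 < p)%N by apply: ltnW.
case: w ordw wT lt_ab => [|v0 s0] ordw wT lt_ab; first by have := wT a.
(* This e makes q larger than 3n + 1, hence larger than the number of local generators at any P. *)
have [Uw _ _ _] := ordw; pose e := (3 * n).+1; pose q := (p ^ e)%N.
have lt_q : (3 * n + 1 < q)%N by rewrite addn1 ltn_expl.
have [taue ltaue taue1] := root_linear_iter ltau tau1 e.
pose ones := (all_ones n *+ q.-1)%MM.
have lt_ones i : (ones i < p ^ e)%N.
  by rewrite mulmnE mnmE mul1n -/q ltn_predL; lia.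
have [Tr lTr coefTr] := root_linear_mpoly chk ltaue lt_ones.
pose E := order_product k v0 s0 ^+ q.-2 * cofactor_monomial k a b.
exists e, (fun F => Tr (E * F)); split.
- exact: root_linear_mull.
- move=> m F; apply: (root_linear_symbolic (@noetherian_mpoly k _)) => //.
    exact: ideal_gen_ideal.
  move=> P mP; have [pP _ _] := mP.
  pose z := order_generators s0 (v0 :: s0) P.
  exists z, (size z * q.-2)%N; split.
  + exact: (order_generators_local erefl ordw wT mP).
  + exact: (local_order_generators erefl ordw wT mP).
  + apply: sub_local_ideal => //; apply: (idealM _ (gen_pow_ideal z _)).
    by apply: gen_powX; have := order_product_gen_pow (P := P) erefl ordw wT.
  (* For h > 0 generators, (h-1)(q-1) <= h(q-2) amounts to h + 1 <= q. *)
  + have := size_order_generators s0 ordw wT P; rewrite -/z -/q.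
    by case: (size z) => [|h] /=; nia.
rewrite /E -mulrA.
have lt_zip : {in zip (v0 :: s0) s0,
    forall ab, (index ab.1 (v0 :: s0) < index ab.2 (v0 :: s0))%N}.
  by move=> [c d]; rewrite mem_zip_behead // => /andP[_ /eqP /= ->].
have [F1 leF] := @order_product_coefficient k n (index^~ (v0 :: s0))
  v0 s0 a b q.-2 Uw wT lt_zip lt_ab.
(* The factor g f_ab supplies the last of the q - 1 copies of the product of all variables. *)
have Eq : q.-2.+1 = q.-1 by lia.
rewrite Eq in F1 leF.
apply: (root_linear_mpoly_eq1 (root_linear0 ltaue) taue1 coefTr F1).
by apply: leq_trans leF _; rewrite -addn1 leq_add2l; lia.
Qed.

End EdgeSplitting.

(** * The symbolic Rees algebra *)

Section PolyFrobenius.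
Local Open Scope ring_scope.

Lemma coef_poly_frobenius (A : comNzRingType) p (F : {poly A}) l :
  p \in [pchar A] ->
  (F ^+ p)`_l = if (p %| l)%N then F`_(l %/ p) ^+ p else 0.
Proof.
move=> chA; have chP : p \in [pchar {poly A}].
  exact: (rmorph_pchar (polyC : {rmorphism A -> {poly A}})).
have p_gt0 : (0 < p)%N by rewrite prime_gt0 // (pcharf_prime chA).
elim/poly_ind: F l => [|F c IHF] l.
  by rewrite expr0n gtn_eqF // !coef0 expr0n gtn_eqF // if_same.
have -> : (F * 'X + c%:P) ^+ p = (F * 'X) ^+ p + (c%:P) ^+ p.
  by apply: exprDn_pchar; rewrite (eq_pnat _ (pcharf_eq chP)) pnat_id // (pcharf_prime chP).
rewrite exprMn coefD coefMXn -polyC_exp coefC !coefD !coefMX !coefC.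
have [lt_lp|le_pl] := ltnP l p.
  rewrite divn_small // eqxx !add0r; have [->|l0] := eqVneq l 0; first by rewrite dvdn0.
  by rewrite gtnNdvd // lt0n.
rewrite IHF [in RHS]gtn_eqF ?divn_gt0 // !addr0.
have [l' ->] : exists l', l = (l' + p)%N by exists (l - p)%N; rewrite subnK.
rewrite addnK dvdn_addl // divnDr // divnn p_gt0 addn1 /=.
by rewrite addn_eq0 [p == 0%N]gtn_eqF // andbF addr0.
Qed.

End PolyFrobenius.

Section SymbolicRees.
Local Open Scope ring_scope.
Local Open Scope classical_set_scope.
Variables (k : fieldType) (N : nat) (I : set {mpoly k[N]}).
Local Notation S := {mpoly k[N]}.
Local Notation R := (symbolic_rees I).
Implicit Types (r s : R) (F : S).

Lemma rees_coefP r m : symbolic_pow I m (rees_val r)`_m.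
Proof. by case: r => F IF /=; move/asboolP: IF; apply. Qed.

Lemma rees_val_inj : injective (@rees_val k N I).
Proof. exact: val_inj. Qed.

Lemma rees_val0 : rees_val (0 : R) = 0.
Proof. exact: (rmorph0 (val : R -> {poly S})). Qed.

Lemma rees_val1 : rees_val (1 : R) = 1.
Proof. exact: (rmorph1 (val : R -> {poly S})). Qed.

Lemma rees_valD r s : rees_val (r + s) = rees_val r + rees_val s.
Proof. exact: (rmorphD (val : R -> {poly S})). Qed.

Lemma rees_valM r s : rees_val (r * s) = rees_val r * rees_val s.
Proof. exact: (rmorphM (val : R -> {poly S})). Qed.

Lemma rees_valX r m : rees_val (r ^+ m) = rees_val r ^+ m.
Proof. exact: (rmorphXn (val : R -> {poly S})). Qed.

Lemma rees_val_sum (T : finType) (F : T -> R) :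
  rees_val (\sum_i F i) = \sum_i rees_val (F i).
Proof. exact: (rmorph_sum (val : R -> {poly S})). Qed.

Lemma rees_domain : GRing.integral_domain_axiom R.
Proof.
move=> r s /(congr1 val); rewrite rmorphM rmorph0 => /eqP; rewrite mulf_eq0.
by case/orP=> /eqP E; apply/orP; [left | right]; apply/eqP/val_inj; rewrite rmorph0.
Qed.

Fact rees_const_subproof F : F%:P \in symbolic_rees_pred I.
Proof.
apply/asboolP => -[|m] //; rewrite coefC /=.
by case: (symbolic_pow_ideal I m.+1).
Qed.

Definition rees_const F : R := SymbolicRees (rees_const_subproof F).

Fact rees_const_zmod : zmod_morphism rees_const.
Proof. by move=> F H; apply: val_inj; rewrite rmorphB /= polyCB. Qed.

Fact rees_const_monoid : monoid_morphism rees_const.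
Proof.
split=> [|F H]; apply: val_inj; first by rewrite rmorph1.
by rewrite rmorphM /= polyCM.
Qed.

HB.instance Definition _ :=
  GRing.isZmodMorphism.Build S R rees_const rees_const_zmod.
HB.instance Definition _ :=
  GRing.isMonoidMorphism.Build S R rees_const rees_const_monoid.

Fact rees_comp_subproof m r :
  ((rees_val r)`_m)%:P * 'X^m \in symbolic_rees_pred I.
Proof.
apply/asboolP => l; rewrite coefCM coefXn; have [->|_] := eqVneq l m.
  by rewrite mulr1; apply: rees_coefP.
by rewrite mulr0; case: (symbolic_pow_ideal I l).
Qed.

Definition rees_comp m r : R := SymbolicRees (rees_comp_subproof m r).

Lemma rees_val_comp m r :
  rees_val (rees_comp m r) = ((rees_val r)`_m)%:P * 'X^m.
Proof. by []. Qed.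

Lemma rees_comp_sum m (T : finType) (F : T -> R) :
  rees_comp m (\sum_i F i) = \sum_i rees_comp m (F i).
Proof.
apply: rees_val_inj; rewrite rees_val_comp !rees_val_sum coef_sum rmorph_sum.
by rewrite mulr_suml.
Qed.

Lemma rees_compM m r s :
  rees_comp m (r * s) = \sum_(l < m.+1) rees_comp l r * rees_comp (m - l) s.
Proof.
apply: rees_val_inj; rewrite rees_val_comp rees_val_sum rees_valM coefM rmorph_sum.
rewrite mulr_suml; apply: eq_bigr => l _; rewrite rees_valM !rees_val_comp rmorphM.
by rewrite mulrACA -exprD subnKC // -ltnS.
Qed.

Lemma rees_decomp r : r = \sum_(m < size (rees_val r)) rees_comp m r.
Proof.
apply: rees_val_inj; rewrite rees_val_sum -[LHS]coefK poly_def.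
by apply: eq_bigr => m _; rewrite rees_val_comp mul_polyC.
Qed.

(** Adjoin to S one variable for each element of [L]; Hilbert's basis theorem keeps the ring
    Noetherian. *)
Lemma rees_noetherian_cover (L : seq R) : noetherian S ->
  exists (A : comNzRingType) (f : {rmorphism A -> R}),
    [/\ noetherian A, forall F, exists a, f a = rees_const F &
        {in L, forall r, exists a, f a = r}].
Proof.
move=> nS; elim: L => [|r L [A [f [nA fconst fL]]]].
  by exists S, rees_const; split=> // F; exists F.
pose g : {rmorphism {poly A} -> R} := horner_eval r \o map_poly f.
have gC a : g a%:P = f a by rewrite /g /= map_polyC /horner_eval hornerC.
exists {poly A}, g; split; first exact: hilbert_basis.
  by move=> F; have [a <-] := fconst F; exists a%:P.
move=> s; rewrite inE => /predU1P[->|/fL[a <-]]; last by exists a%:P.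
by exists 'X; rewrite /g /= map_polyX /horner_eval hornerX.
Qed.

Variable p : nat.
Hypothesis chR : p \in [pchar R].
Hypothesis chk : p \in [pchar k].
Let chS : p \in [pchar S] := rmorph_pchar (@mpolyC N k) chk.

Lemma rees_comp_frobenius m r :
  rees_comp m (r ^+ p) = if (p %| m)%N then rees_comp (m %/ p) r ^+ p else 0.
Proof.
apply: rees_val_inj; rewrite rees_val_comp rees_valX coef_poly_frobenius //.
case: ifP => [/divnK Em|_]; last by rewrite mul0r rees_val0.
by rewrite rees_valX rees_val_comp exprMn polyC_exp -exprM Em.
Qed.

(* F-finiteness makes R a finitely generated S-algebra: in t-degree m > 0 an
   element sum_i a_i^p s_i only involves components of a_i of degree <= m / p. *)
Lemma rees_noetherian : noetherian S ->
  finitely_generated (qroot_ring chR 1 : lmodType R) -> noetherian R.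
Proof.
(* The homogeneous components of the module generators will generate R as an S-algebra. *)
move=> nS [s gens]; pose L := [seq rees_comp l r | r <- s, l <- iota 0 (size (rees_val r))].
have [A [f [nA fconst fL]]] := rees_noetherian_cover L nS.
apply: (noetherian_surj (f := f)) nA.
have p_gt1 : (1 < p)%N by rewrite prime_gt1 // (pcharf_prime chR).
pose B r := exists a, f a = r.
have B0 : B 0 by exists 0; rewrite rmorph0.
have BD r1 r2 : B r1 -> B r2 -> B (r1 + r2).
  by case=> a <- [b <-]; exists (a + b); rewrite rmorphD.
have BM r1 r2 : B r1 -> B r2 -> B (r1 * r2).
  by case=> a <- [b <-]; exists (a * b); rewrite rmorphM.
have BX r : B r -> B (r ^+ p) by case=> a <-; exists (a ^+ p); rewrite rmorphXn.
have Bs (i : 'I_(size s)) l : B (rees_comp l s`_i).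
  have [lt_l|le_l] := ltnP l (size (rees_val s`_i)).
    apply: fL; apply/allpairsPdep; exists s`_i, l.
    by rewrite mem_nth // mem_iota.
  suff -> : rees_comp l s`_i = 0 by [].
  by apply: rees_val_inj; rewrite rees_val_comp nth_default // polyC0 mul0r rees_val0.
suff Bcomp m r : B (rees_comp m r).
  by move=> r; rewrite [r]rees_decomp; apply: (big_ind B).
elim/ltn_ind: m r => -[|m] IHm r.
  have [a Ea] := fconst (rees_val r)`_0; exists a; rewrite Ea.
  by apply: val_inj; rewrite /= expr0 mulr1.
have [a ->] := gens r; rewrite rees_comp_sum; apply: (big_ind B) => // i _.
rewrite qroot_scaleE [rees_comp _ _]rees_compM; apply: (big_ind B) => // l _.
apply: BM; last exact: Bs.
rewrite /qroot_incl /qroot expn1 rees_comp_frobenius; case: ifP => // _.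
apply: BX; apply: IHm; have := ltn_ord l; rewrite ltnS => le_l.
by apply: leq_ltn_trans (leq_div2r p le_l) _; rewrite ltn_Pdiv.
Qed.

(** Setting t and all variables to 0 maps R onto k, so the images of the generators of R^{1/p} show
    that k is finite over k^p. *)
Lemma rees_functional :
  finitely_generated (qroot_ring chR 1 : lmodType R) ->
  exists2 tau : k -> k, root_linear p 1 tau & tau 1 = 1.
Proof.
move=> [s gens]; pose ev (r : R) : k := (rees_val r)`_0@_0%MM.
have ev1 : ev 1 = 1 by rewrite /ev rees_val1 coef1 mcoeff1 eqxx.
have evM r1 r2 : ev (r1 * r2) = ev r1 * ev r2.
  by rewrite /ev rees_valM coef0M (rmorphM (mcoeff 0%MM : S -> k)).
have evX r d : ev (r ^+ d) = ev r ^+ d.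
  by elim: d => [|d IHd]; rewrite ?expr0 // !exprS evM IHd.
apply: (root_linear_functional chk (s := fun i : 'I_(size s) => ev s`_i)) => u.
have [a Ea] := gens (rees_const u%:MP); exists (fun i => ev (a i)).
have -> : u = ev (rees_const u%:MP) by rewrite /ev /= coefC mcoeffC eqxx mulr1.
rewrite {1}Ea /ev rees_val_sum coef_sum raddf_sum /=; apply: eq_bigr => i _.
rewrite -[LHS]/(ev (a i ^+ (p ^ 1) * s`_i)).
by rewrite evM evX expn1.
Qed.

Lemma root_linear_rees e (Phi : {poly S} -> {poly S}) : root_linear p e Phi ->
  (forall r m, symbolic_pow I m (Phi (rees_val r))`_m) ->
  exists2 phi : R -> R, root_linear p e phi &
    forall r, rees_val (phi r) = Phi (rees_val r).
Proof.
move=> [PhiD PhiM] PhiR.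
have PhiP r : Phi (rees_val r) \in symbolic_rees_pred I by apply/asboolP.
exists (fun r => SymbolicRees (PhiP r)) => //; split=> [r s|a r]; apply: rees_val_inj.
  by rewrite [RHS]rees_valD -[LHS]/(Phi _) rees_valD PhiD.
by rewrite [RHS]rees_valM -[LHS]/(Phi _) rees_valM rees_valX PhiM.
Qed.

Section RootLinearMap.
Variables (e : nat) (phi : R -> R).
Hypothesis lphi : root_linear p e phi.

(** The proof is an argument so that the linear structure can be attached to the term. *)
Definition root_linear_map of root_linear p e phi : qroot_ring chR e -> R^o := phi.

Fact root_linear_map_linear : linear (root_linear_map lphi).
Proof.
case: lphi => phiD phiM a u v; rewrite /root_linear_map.
by rewrite [phi _]phiD [phi (a *: u)]phiM.
Qed.

HB.instance Definition _ :=
  GRing.isLinear.Build R (qroot_ring chR e) R^o *:%R (root_linear_map lphi)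
    root_linear_map_linear.

End RootLinearMap.

Lemma root_linear_split e (phi : R -> R) c : root_linear p e phi -> phi c = 1 ->
  exists psi : {linear qroot_ring chR e -> R^o},
    forall r : R, psi (r *: qroot chR e c) = r.
Proof.
move=> lphi phic; exists (root_linear_map lphi) => r.
by rewrite /= /root_linear_map [LHS](proj2 lphi) phic mulr1.
Qed.

(* Phi sends R into S[t]; since R^{1/q} is finitely generated over R, a power
   of c in I pushes the image back into R. *)
Lemma root_linear_into_rees e (Phi : {poly S} -> {poly S}) c :
  noetherian S -> finitely_generated (qroot_ring chR e : lmodType R) ->
  I c -> root_linear p e Phi ->
  exists M (phi : R -> R), root_linear p e phi /\
    forall r, rees_val (phi r) = (c ^+ M)%:P * Phi (rees_val r).
Proof.
move=> nS [s gens] Ic lPhi; have [PhiD PhiM] := lPhi.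
pose d (i : 'I_(size s)) := size (Phi (rees_val s`_i)).
(* M bounds the exponents m of t in the images of the generators, so c^M is divisible by c^m, which
   lies in I^m. *)
pose M := (\max_(i < size s) d i)%N.
have lcPhi := root_linear_scale (c ^+ M)%:P lPhi.
have in_s (i : 'I_(size s)) m : symbolic_pow I m ((c ^+ M)%:P * Phi (rees_val s`_i))`_m.
  rewrite coefCM; have [_ _ KM] := symbolic_pow_ideal I m.
  have [le_m|lt_m] := leqP (size (Phi (rees_val s`_i))) m.
    by rewrite nth_default // mulr0; case: (symbolic_pow_ideal I m).
  have le_mM : (m <= M)%N.
    by apply: leq_trans (ltnW lt_m) _; apply: (leq_bigmax (F := d)).
  rewrite mulrC -(subnK le_mM) exprD; apply: (KM); apply: (KM).
  case: m {lt_m le_mM KM} => // m; apply: ideal_pow_sub_symbolic => //.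
  exact: ideal_powX.
(* The coefficients a_i^q leave [Phi] as elements a_i of R, so the generators suffice. *)
have in_R r m : symbolic_pow I m ((c ^+ M)%:P * Phi (rees_val r))`_m.
  have [a ->] := gens r; rewrite rees_val_sum [Phi _](root_linear_sum lPhi).
  rewrite mulr_sumr coef_sum; apply: ideal_sum; first exact: symbolic_pow_ideal.
  move=> i _; rewrite [a i *: _]qroot_scaleE rees_valM rees_valX PhiM mulrCA.
  have inP : (c ^+ M)%:P * Phi (rees_val s`_i) \in symbolic_rees_pred I.
    by apply/asboolP.
  by rewrite -[_ * Phi _]/(rees_val (SymbolicRees inP)) -rees_valM; apply: rees_coefP.
have [phi lphi phiE] := root_linear_rees lcPhi in_R.
by exists M, phi.
Qed.

End SymbolicRees.

(** * Splitting every nonzero element of the symbolic Rees algebra *)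

Section Splitting.
Local Open Scope ring_scope.
Local Open Scope classical_set_scope.

(** Pick a monomial in the leading coefficient of d and normalize its coefficient to 1; once q
    exceeds all degrees involved, only this term survives. The last clause serves graphs without
    edges. *)
Lemma root_linear_poly_mpoly_eq1 (k : fieldType) p N (tau : k -> k)
    (d : {poly {mpoly k[N]}}) :
  p \in [pchar k] -> root_linear p 1 tau -> tau 1 = 1 -> d != 0 ->
  exists e (Phi : {poly {mpoly k[N]}} -> {poly {mpoly k[N]}}),
    [/\ root_linear p e Phi, Phi d = 1 &
        forall (F : {poly {mpoly k[N]}}) m,
          (forall l, (0 < l)%N -> F`_l = 0) -> (0 < m)%N -> (Phi F)`_m = 0].
Proof.
move=> chk ltau tau1 d0.
have p_gt1 : (1 < p)%N by rewrite prime_gt1 // (pcharf_prime chk).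
pose j := (size d).-1; have dj0 : d`_j != 0 by rewrite -lead_coefE lead_coef_eq0.
have [a da] : exists a, a \in msupp d`_j.
  case E : (msupp d`_j) => [|a s]; last by exists a; rewrite mem_head.
  by rewrite (msuppnil0 E) eqxx in dj0.
pose c := (d`_j@_a)^-1; have ca : c * d`_j@_a = 1 by rewrite mulVf // -mcoeff_msupp.
pose e := (size d + mdeg a + msize (c%:MP * d`_j))%N.
have lt_e : (e < p ^ e)%N by apply: ltn_expl.
have [taue ltaue taue1] := root_linear_iter ltau tau1 e.
have lt_a i : (a i < p ^ e)%N.
  have : (a i <= mdeg a)%N by rewrite mdegE (bigD1 i) //= leq_addr.
  by move: lt_e; rewrite /e; lia.
have [Theta lTheta coefT] := root_linear_mpoly chk ltaue lt_a.
have lcTheta := root_linear_mull c%:MP lTheta.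
have lt_j : (j < p ^ e)%N by move: lt_e; rewrite /e /j; lia.
have chS : p \in [pchar {mpoly k[N]}] := rmorph_pchar (@mpolyC N k) chk.
have [Phi lPhi PhiE] := root_linear_poly chS lcTheta lt_j.
have T0 : Theta (c%:MP * 0) = 0 := root_linear0 lcTheta.
exists e, Phi; split=> // [|F m F0 m_gt0]; last first.
  by rewrite PhiE F0 ?T0 // addn_gt0 muln_gt0 m_gt0; have -> : (0 < p ^ e)%N by lia.
apply/polyP => m; rewrite PhiE coef1; case: m => [|m] /=.
  rewrite mul0n add0n; apply: (root_linear_mpoly_eq1 (root_linear0 ltaue) taue1 coefT).
    by rewrite mcoeffCM.
  apply: leq_trans (leq_trans _ (ltnW lt_e)) (leq_addl _ _).
  exact: leq_addl.
have le_d : (size d <= p ^ e)%N by move: lt_e; rewrite /e; lia.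
rewrite nth_default ?T0 //; apply: leq_trans le_d _.
by rewrite mulSn -addnA leq_addr.
Qed.

Lemma poly_root_linearC (A : comNzRingType) q (theta : A -> A)
    (Phi : {poly A} -> {poly A}) u :
  (0 < q)%N -> theta 0 = 0 -> theta u = 1 ->
  (forall F m, (Phi F)`_m = theta F`_(m * q + 0)) -> Phi u%:P = 1.
Proof.
move=> q_gt0 theta0 thetau PhiE; apply/polyP => m.
rewrite PhiE addn0 coef1 coefC muln_eq0 [(q == 0)%N]gtn_eqF // orbF.
by case: eqP.
Qed.

Lemma minimal_prime0 (A : comNzRingType) :
  GRing.integral_domain_axiom A -> minimal_prime [set 0] [set 0 : A].
Proof.
move=> domA; split=> // [|P' [iP' _ _] _ s2]; last first.
  by apply/seteqP; split=> // _ ->; case: iP'.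
split=> [|/eqP|x y /domA /orP[]/eqP].
- by split=> [|x y -> ->|a x ->] //=; rewrite ?addr0 ?mulr0.
- by rewrite oner_eq0.
- by left.
- by right.
Qed.

Lemma symbolic_pow0 (A : comNzRingType) m (F : A) :
  GRing.integral_domain_axiom A -> noetherian A -> (0 < m)%N ->
  symbolic_pow [set 0] m F -> F = 0.
Proof.
move=> domA nA m_gt0 F0; have min0 := minimal_prime0 domA.
have [[i0 _ _] _ _] := min0.
have [s s0] := (symbolic_powP [set 0] F nA m_gt0).1 F0 _ min0.
by move=> /(ideal_pow_sub m_gt0 i0 (fun x => id)) /domA /orP[]/eqP.
Qed.

Lemma rees_root_linear_eq1 (k : fieldType) (p : nat) (chk : p \in [pchar k])
    (n : nat) (G : sgraph 'I_n) (c : symbolic_rees (binomial_edge_ideal k G)) :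
  (forall i, i \in vertices G) -> pendant_cliques G ->
  F_finite (symbolic_rees_pchar (binomial_edge_ideal k G) chk) -> c != 0 ->
  exists e (phi : symbolic_rees (binomial_edge_ideal k G) ->
                  symbolic_rees (binomial_edge_ideal k G)),
    root_linear p e phi /\ phi c = 1.
Proof.
set J := binomial_edge_ideal k G in c *.
set chR := symbolic_rees_pchar J chk => spanG pcG finR c0.
have nS := @noetherian_mpoly k (n + n).
have p_gt0 : (0 < p)%N by rewrite prime_gt0 // (pcharf_prime chk).
have vc0 : rees_val c != 0.
  by apply: contra_neq c0 => Ec; apply: rees_val_inj; rewrite Ec rees_val0.
have [tau ltau tau1] := rees_functional chk (finR 1%N).
have [e1 [Psi [lPsi Psic Psi0]]] := root_linear_poly_mpoly_eq1 chk ltau tau1 vc0.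
(* Without edges J = 0, so the elements of R are constant in t and [Psi] itself preserves R; there
   is no f to multiply by. *)
have [[a [b ab]]|noedge] := pselect (exists a b, edge G a b); last first.
  have domS : GRing.integral_domain_axiom {mpoly k[n + n]}.
    by move=> F H /eqP; rewrite mulf_eq0.
  have J0 : J = [set 0].
    have iJ : is_ideal J by apply: ideal_gen_ideal.
    apply/seteqP; split; last by move=> _ ->; case: iJ.
    apply: ideal_gen_sub.
      by have [[]] := minimal_prime0 domS.
    by move=> F [a [b [ab _]]]; case: noedge; exists a, b.
  have coef0 (r : symbolic_rees J) m : (0 < m)%N -> (rees_val r)`_m = 0.
    move=> m_gt0; have := rees_coefP r m; move: (_`_m) => F.
    by rewrite -/J J0; apply: symbolic_pow0.
  have in_R (r : symbolic_rees J) m : symbolic_pow J m (Psi (rees_val r))`_m.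
    case: m => [//|m]; rewrite Psi0 // => [|l]; last exact: coef0.
    by case: (symbolic_pow_ideal J m.+1).
  have [phi lphi phiE] := root_linear_rees lPsi in_R.
  exists e1, phi; split=> //; apply: rees_val_inj.
  by rewrite phiE Psic rees_val1.
have [w ordw] := pendant_cliques_order pcG.
have wT v : v \in w by have [_ <- _ _] := ordw.
wlog lt_ab : a b ab / (index a w < index b w)%N.
  move=> Hab; have [lt_ab|lt_ba|E] := ltngtP (index a w) (index b w).
  - exact: (Hab a b).
  - by apply: (Hab b a); rewrite // edge_sym.
  - by move: ab; rewrite (index_inj a (wT a) (wT b) E) edge_irr.
have [e [Theta [lTheta ThetaJ Theta1]]] := edge_splitting chk ltau tau1 ordw wT lt_ab.
have chS : p \in [pchar {mpoly k[n + n]}] := rmorph_pchar (@mpolyC (n + n) k) chk.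
have q_gt0 f : (0 < p ^ f)%N by rewrite expn_gt0 p_gt0.
have [Phi lPhi PhiE] := root_linear_poly chS lTheta (q_gt0 e).
have [phi lphi phiE] : exists2 phi : symbolic_rees J -> symbolic_rees J,
    root_linear p e phi & forall r, rees_val (phi r) = Phi (rees_val r).
  apply: root_linear_rees => // r m; rewrite PhiE addn0; apply: ThetaJ.
  exact: rees_coefP.
pose f : symbolic_rees J := rees_const J (edge_binomial k a b).
have phif : phi f = 1.
  apply: rees_val_inj; rewrite phiE rees_val1.
  exact: (poly_root_linearC (q_gt0 e) (root_linear0 lTheta) Theta1 PhiE).
have Jf : J (edge_binomial k a b) by apply: edge_binomial_in.
have [M [psi [lpsi psiE]]] := root_linear_into_rees nS (finR e1) Jf lPsi.
have psic : psi c = f ^+ M.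
  by apply: rees_val_inj; rewrite psiE Psic mulr1 rees_valX polyC_exp.
(* [psi] sends c to f^M, and [chi], built from the map with f going to 1, sends f^M to 1. *)
have [e2 [chi [lchi chif]]] := root_linear_power p_gt0 lphi phif M.
exists (e2 + e1)%N, (chi \o psi); split; first exact: root_linear_comp.
by rewrite /= psic.
Qed.

End Splitting.

Theorem proposition3p12 (k : fieldType) (p : nat) (chk : p \in [pchar k]%R)
    (n : nat) (G : sgraph 'I_n)
    (spanG : forall i : 'I_n, i \in vertices G) (pcG : pendant_cliques G)
    (finR : F_finite (symbolic_rees_pchar (binomial_edge_ideal k G) chk)) :
  strongly_F_regular (symbolic_rees_pchar (binomial_edge_ideal k G) chk).
Proof.
have nS := @noetherian_mpoly k (n + n).
split=> // [||c nPc].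
- exact: rees_domain.
- exact: (rees_noetherian chk nS (finR 1%N)).
have [|e [phi [lphi phic]]] := rees_root_linear_eq1 (c := c) spanG pcG finR.
  (* In a domain the zero ideal is a minimal prime, so c is nonzero. *)
  by apply/eqP => Ec; apply: nPc (minimal_prime0 (@rees_domain _ _ _)) Ec.
by exists e; apply: (root_linear_split _ lphi phic).
Qed.
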